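(* Let $m\ge 2$ be an integer, let $I,J\subset\mathbb{R}$ be open intervals, and let $g:I\to\mathbb{R}$, $h:J\to\mathbb{R}$ be smooth functions such that $g(u)\ne0$, $g'(u)\neq0$ for all $u\in I$ and $h(v)\neq 0$, $h'(v)\ne 0$ for all $v\in J$. Let $M$ be the homothetical surface in $(\mathbb{R}^3,\|\cdot\|_{2m})$ parametrized by $X(u,v)=(u,v,g(u)h(v))$, $(u,v)\in I\times J$. Then $M$ is minimal if and only if it is given by $$X(u,v)=\left(u,\ v,\ (au+b)\,\Psi^{-1}(v)\right),$$ where $a\ne0$, $b$, $c_2\neq 0$ are constants and $\Psi$ is defined by $$v=\frac1{c_2}\int\frac{1}{\left(a^{\frac{2m-2}{2m-1}}+a^2h^{\frac{2m}{2m-1}}\right)^{\frac{2m-1}{m}}}\,dh=:\Psi(h).$$ This surface is reparametrized, with parameters $u$ and $h=\Psi^{-1}(v)$, as $$X(u,h)=\left(u,\ \Psi(h),\ (au+b)h\right).$$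
   Context: $\|x\|_{2m}=(x_1^{2m}+x_2^{2m}+x_3^{2m})^{1/(2m)}$ on $\mathbb{R}^3$, $\Phi(x)=x_1^{2m}+x_2^{2m}+x_3^{2m}$, and $S=\{x\in\mathbb{R}^3:\Phi(x)=1\}$ is the unit sphere. A nonzero vector $v$ is Birkhoff orthogonal to a plane $\Pi$ if the tangent plane of $S$ at $v/\|v\|_{2m}$ is parallel to $\Pi$. For an immersed surface $M$, the (local) Birkhoff-Gauss map $\eta:M\to S$ is a smooth choice of $\eta(p)\in S$ Birkhoff orthogonal to $T_pM$; for a parametrization $X(u,v)$ it is characterized by $(\operatorname{grad}\Phi)_{\eta}=\varphi\,X_u\times X_v$ for a positive function $\varphi$ (with $\times$ the standard cross product). Since the tangent plane of $S$ at $\eta(p)$ is parallel to $T_pM$, $d\eta_p$ is regarded as an endomorphism of $T_pM$. The mean curvature is $H=\frac12\operatorname{trace}(d\eta_p)$, and $M$ is called minimal if $H=0$ identically. For real $x$ and integer $k\ge 0$, $x^{\frac{k}{2m-1}}$ means $(x^{\frac1{2m-1}})^k$, where $x^{\frac{1}{2m-1}}$ is the real $(2m-1)$-th root (so it is defined for negative $x$ too). The integral defining $\Psi$ denotes an antiderivative in the variable $h$; $\Psi$ is strictly monotone, and $\Psi^{-1}$ is its inverse. The parameters are restricted to intervals on which the two factors of the third coordinate, $g(u)=au+b$ and $h(v)=\Psi^{-1}(v)$, and their derivatives are nonzero.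
   Formalization: Read literally the ''only if'' is false (take h(v)=v and g an inverse of such a Ψ); the formal theorem says M is minimal if and only if it has the displayed form or the form with u and v interchanged, (u, v, (av+b)Ψ^{-1}(u)). *)

(* Defs.v *)
From HB Require Import structures.
From mathcomp Require Import all_boot all_order all_algebra.
From mathcomp Require Import all_classical all_reals all_analysis.
Set Implicit Arguments.
Unset Strict Implicit.
Unset Printing Implicit Defensive.
Import Order.TTheory GRing.Theory Num.Theory.
Import numFieldNormedType.Exports.
Local Open Scope classical_set_scope.
Local Open Scope ring_scope.

Section Defs.
Context {R : realType}.
Implicit Types (m : nat) (I J K : set R) (x y w q : 'rV[R]_3).

Definition row3 (a b c : R) : 'rV[R]_3 := \row_(j < 3) [:: a; b; c]`_j.

Definition crossprod x y : 'rV[R]_3 :=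
  let i0 := inord 0 : 'I_3 in let i1 := inord 1 in let i2 := inord 2 in
  row3 (x 0 i1 * y 0 i2 - x 0 i2 * y 0 i1)
       (x 0 i2 * y 0 i0 - x 0 i0 * y 0 i2)
       (x 0 i0 * y 0 i1 - x 0 i1 * y 0 i0).

Definition open_interval I := [/\ open I, is_interval I & I !=set0].

(* As [I] is open, the iterated derivatives of the total function [f] at the
   points of [I] only depend on the restriction of [f] to [I]. *)
Definition smooth_on I (f : R -> R) :=
  forall n t, I t -> derivable (derive1n n f) t 1.

Definition diffeomorphism K J (f f' : R -> R) :=
  [/\ open K /\ open J,
      {homo f : s / K s >-> J s} /\ {homo f' : t / J t >-> K t},
      (forall s, K s -> f' (f s) = s) /\ (forall t, J t -> f (f' t) = t)
    & smooth_on K f /\ smooth_on J f'].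

Section TwoParameters.
Context {V : normedModType R}.
Implicit Types F : R -> R -> V.

Definition partial1 F : R -> R -> V := fun u v => derive1 (F^~ v) u.
Definition partial2 F : R -> R -> V := fun u v => derive1 (F u) v.

Fixpoint Ck2_on (k : nat) I J F : Prop :=
  (forall u v, I u -> J v -> {for (u, v), continuous (fun p => F p.1 p.2)}) /\
  if k is k'.+1 then
    [/\ forall u v, I u -> J v ->
          derivable (F^~ v) u 1 /\ derivable (F u) v 1,
        Ck2_on k' I J (partial1 F)
      & Ck2_on k' I J (partial2 F)]
  else True.

Definition smooth2_on I J F := forall k, Ck2_on k I J F.
End TwoParameters.

Definition Phi m x : R := \sum_(i < 3) x 0 i ^+ (2 * m).

Definition norm2m m x : R := Phi m x `^ ((2 * m)%:R^-1).

Definition unit_sphere m : set 'rV[R]_3 := [set x | Phi m x = 1].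

Definition grad (f : 'rV[R]_3 -> R) q : 'rV[R]_3 :=
  \row_(j < 3) 'D_(delta_mx 0 j) f q.

(* Direction of the tangent plane at [q] of the level set of [Phi] through [q];
   planes are compared up to parallelism, i.e. through their directions. *)
Definition sphere_tangent m q : set 'rV[R]_3 := [set w | 'D_w (Phi m) q = 0].

Definition birkhoff_orthogonal m (v : 'rV[R]_3) (P : set 'rV[R]_3) :=
  v != 0 /\ sphere_tangent m ((norm2m m v)^-1 *: v) = P.

(* The rows of [frame X u v] are X_u and X_v. *)
Definition frame (X : R -> R -> 'rV[R]_3) u v : 'M[R]_(1 + 1, 3) :=
  col_mx (partial1 X u v) (partial2 X u v).

Definition tangent_plane (X : R -> R -> 'rV[R]_3) u v : set 'rV[R]_3 :=
  [set w | (w <= frame X u v)%MS].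

(* [N u v] is eta (X u v). The last clause only fixes the sign of eta: it
   singles out one of the two opposite Birkhoff normals. *)
Definition birkhoff_gauss m I J (X N : R -> R -> 'rV[R]_3) :=
  smooth2_on I J N /\
  forall u v, I u -> J v ->
    [/\ unit_sphere m (N u v),
        birkhoff_orthogonal m (N u v) (tangent_plane X u v)
      & exists2 phi : R, 0 < phi &
          grad (Phi m) (N u v) =
            phi *: crossprod (partial1 X u v) (partial2 X u v)].

(* When the rows N_u, N_v lie in the span of X_u, X_v, the matrix
   [frame N u v *m pinvmx (frame X u v)] is the unique A such that
   [frame N u v = A *m frame X u v] (see [mulmxKpV]), that is the matrix of
   d(eta) in the basis (X_u, X_v), acting on row vectors. *)
Definition mean_curvature (X N : R -> R -> 'rV[R]_3) u v : R :=
  2^-1 * \tr (frame N u v *m pinvmx (frame X u v)).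

Definition minimal_surface m I J (X : R -> R -> 'rV[R]_3) :=
  exists2 N, birkhoff_gauss m I J X N &
    forall u v, I u -> J v -> mean_curvature X N u v = 0.

Definition homothetical (g h : R -> R) : R -> R -> 'rV[R]_3 :=
  fun u v => row3 u v (g u * h v).

(* The real n-th root for odd n, also at negative arguments. *)
Definition odd_root (n : nat) (t : R) : R := Num.sg t * `|t| `^ (n%:R^-1).

Lemma odd_rootK n t : odd n -> odd_root n t ^+ n = t.
Proof.
move=> on; have n0 : n != 0%N by case: n on.
rewrite /odd_root exprMn -(powR_mulrn _ (powR_ge0 _ _)) -powRrM.
rewrite mulVf ?pnatr_eq0// powRr1//.
have [->|t0] := eqVneq t 0; first by rewrite normr0 mulr0.
by rewrite sgr_odd// on expr1 -numEsg.
Qed.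

(* t ^ (k / (2m - 1)) *)
Definition root_pow m (k : nat) (t : R) : R := odd_root (2 * m - 1) t ^+ k.

(* [Psi] is an antiderivative on the whole line of the integrand (which is
   defined and continuous everywhere when [a != 0]). *)
Definition Psi_antiderivative m (a c2 : R) (Psi : R -> R) :=
  forall s : R, is_derive s (1 : R) Psi
    (c2^-1 * (1 / (root_pow m (2 * m - 2) a + a ^+ 2 * root_pow m (2 * m) s)
                    `^ ((2 * m - 1)%:R / m%:R))).

(* [Psi_inv] is the inverse of [Psi], whose range contains [J]. *)
Definition inverse_on J (Psi Psi_inv : R -> R) :=
  cancel Psi Psi_inv /\ (forall t, J t -> Psi (Psi_inv t) = t).

Definition Psi_data m J (a c2 : R) (Psi Psi_inv : R -> R) :=
  [/\ a != 0, c2 != 0, Psi_antiderivative m a c2 Psi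
    & inverse_on J Psi Psi_inv].

Definition equal_on I J (X Y : R -> R -> 'rV[R]_3) :=
  forall u v, I u -> J v -> X u v = Y u v.

End Defs.

(* Main.v *)
Require Import Defs.
From HB Require Import structures.
From mathcomp Require Import all_boot all_order all_algebra.
From mathcomp Require Import all_classical all_reals all_analysis.
From mathcomp Require Import zify ring lra.
Set Implicit Arguments.
Unset Strict Implicit.
Unset Printing Implicit Defensive.
Import Order.TTheory GRing.Theory Num.Theory.
Import numFieldNormedType.Exports.
Local Open Scope classical_set_scope.
Local Open Scope ring_scope.

(** Writing [f u v = g u * h v], the Birkhoff normal of the graph of [f] is
    [eta = (- p n, - q n, n)], where [p] and [q] are the [(2m-1)]-th roots of
    [f_u] and [f_v] and [n] normalizes; [2 H] is the trace of [d eta], that is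
    [(eta_1)_u + (eta_2)_v]. Implicit differentiation turns [H = 0] into an
    equation which, with [w t = t^(2m/(2m-1))], has the form
    [B (1 + G C) + F (1 + E K) = 2], where [B = g g'' / g'^2], [G = 1 / w g],
    [E = 1 / w g'] depend on [u] only, and [F = h h'' / h'^2], [K = 1 / w h],
    [C = 1 / w h'] on [v] only. If neither [E] nor [C] is constant, mixed
    differences make [B], [B G] affine in [E] and [F], [F K] affine in [C]; as
    [E' / E = B G' / G], differentiating forces [G = la E] and [K = - la C] for
    one constant [la], which is absurd since all four are positive. Hence
    [g'' = 0] or [h'' = 0]. If [g = a u + b], the remaining equation has the
    first integral [h' (a^((2m-2)/(2m-1)) + a^2 w h)^(-(2m-1)/m) = c2], whose
    quadrature is [Psi]. *)

(** * Odd roots *)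

Section OddRoot.
Context {R : realType}.
Implicit Types (n m : nat) (s t x : R).

Lemma odd_root_exprK n x : odd n -> odd_root n (x ^+ n) = x.
Proof.
move=> on; have n0 : n != 0%N by case: n on.
rewrite /odd_root normrX -(powR_mulrn n (normr_ge0 x)) -powRrM divff ?pnatr_eq0// powRr1//.
have [->|x0] := eqVneq x 0; first by rewrite normr0 mulr0.
by rewrite sgrX sgr_odd// on expr1 -numEsg.
Qed.

Lemma odd_rootM n s t : odd_root n (s * t) = odd_root n s * odd_root n t.
Proof. by rewrite /odd_root sgrM normrM powRM// mulrACA. Qed.

Lemma odd_root_eq0 n t : odd n -> (odd_root n t == 0) = (t == 0).
Proof.
move=> on; have n0 : (0 < n)%N by case: n on.
by rewrite -[in RHS](odd_rootK t on) expf_eq0 n0.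
Qed.

(* Unlike the definition, this form has no sign, and [t ^+ 2 > 0] for [t != 0]:
   it gives smoothness away from [0] at once. *)
Lemma odd_root_powR n t :
  odd_root n t = t * (t ^+ 2) `^ ((n%:R^-1 - 1) / 2).
Proof.
have [->|t0] := eqVneq t 0; first by rewrite /odd_root sgr0 !mul0r.
rewrite /odd_root -[t ^+ 2]real_normK ?num_real// -(powR_mulrn 2 (normr_ge0 t)) -powRrM.
rewrite [2 * _]mulrC divfK// powRB; last by rewrite normr_eq0 t0 implybT.
rewrite powRr1// [X in _ = X * _]numEsg -mulrA (mulrC `|t|) divfK//.
by rewrite normr_eq0.
Qed.

Lemma odd_2m1 m : (0 < m)%N -> odd (2 * m - 1).
Proof. by move=> m0; rewrite mul2n oddB ?odd_double// double_gt0. Qed.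

Lemma root_powM m k s t : root_pow m k (s * t) = root_pow m k s * root_pow m k t.
Proof. by rewrite /root_pow odd_rootM exprMn. Qed.

(** An even power removes the sign of the root, so the function is a real power of [t ^+ 2], also at
    [0], where both sides vanish. *)
Lemma root_pow_powR m t : (0 < m)%N ->
  root_pow m (2 * m) t = (t ^+ 2) `^ (m%:R / (2 * m - 1)%:R).
Proof.
move=> m0; have on := odd_2m1 m0; rewrite /root_pow.
have n0 : (2 * m - 1)%:R != 0 :> R by rewrite pnatr_eq0; case: (2 * m - 1)%N on.
have [->|t0] := eqVneq t 0.
  rewrite /odd_root sgr0 mul0r expr0n muln_eq0/= gtn_eqF// expr0n/= powR0//.
  by rewrite mulf_neq0 ?invr_neq0// pnatr_eq0 -lt0n.
rewrite /odd_root exprMn sgr_def t0 exprM sqrr_sign expr1n mul1r.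
rewrite -(powR_mulrn (2 * m) (powR_ge0 _ _)) -powRrM.
rewrite -[t ^+ 2]real_normK ?num_real// -(powR_mulrn 2 (normr_ge0 t)) -powRrM natrM.
by congr (_ `^ _); rewrite mulrC mulrA.
Qed.

Lemma root_pow_gt0 m t : (0 < m)%N -> t != 0 -> 0 < root_pow m (2 * m) t.
Proof. by move=> m0 t0; rewrite root_pow_powR// powR_gt0// exprn_even_gt0. Qed.

Lemma root_pow_ge0 m t : (0 < m)%N -> 0 <= root_pow m (2 * m) t.
Proof. by move=> m0; rewrite root_pow_powR// powR_ge0. Qed.

Lemma root_pow2m2_gt0 m t : (0 < m)%N -> t != 0 -> 0 < root_pow m (2 * m - 2) t.
Proof.
move=> m0 t0; rewrite -[X in (_ - X)%N]/(2 * 1)%N -mulnBr /root_pow exprM.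
by rewrite exprn_gt0// exprn_even_gt0//= odd_root_eq0// odd_2m1.
Qed.

(** The two exponents add up to twice [2 * m - 1]. This trades every power of exponent [2 * m - 2]
    for one of exponent [2 * m], so that a single multiplicative function remains. *)
Lemma root_pow2m2M m t : (0 < m)%N ->
  root_pow m (2 * m - 2) t * root_pow m (2 * m) t = t ^+ 2.
Proof.
move=> m0; rewrite /root_pow -exprD.
have -> : (2 * m - 2 + 2 * m = (2 * m - 1) * 2)%N by lia.
by rewrite exprM odd_rootK// odd_2m1.
Qed.

Lemma root_pow2m2E m t : (0 < m)%N -> t != 0 ->
  root_pow m (2 * m - 2) t = t ^+ 2 / root_pow m (2 * m) t.
Proof.
by move=> m0 t0; rewrite -(root_pow2m2M t m0) mulfK// gt_eqF// root_pow_gt0.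
Qed.

Lemma is_derive_root_pow m t : (0 < m)%N -> t != 0 ->
  is_derive t (1 : R) (root_pow m (2 * m))
    ((2 * m)%:R / (2 * m - 1)%:R * root_pow m (2 * m) t / t).
Proof.
move=> m0 t0; have on := odd_2m1 m0.
have -> : root_pow m (2 * m) =
    (fun x => x `^ (m%:R / (2 * m - 1)%:R)) \o (fun t => t ^+ 2) :> (R -> R).
  by apply/funext => x; rewrite root_pow_powR.
have t2 : 0 < t ^+ 2 by rewrite exprn_even_gt0.
have dsq : is_derive t (1 : R) (fun t => t ^+ 2) (2 * t).
  have := @is_deriveX R R id 2 t 1 1 (is_derive_id _ _).
  by rewrite expr1 /GRing.scale/= mulr1.
have dp := is_derive1_powR (m%:R / (2 * m - 1)%:R) t2.
apply: is_derive_eq; rewrite powRB ?(gt_eqF t2) ?implybT// powRr1 ?ltW//= natrM.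
have n0 : (2 * m - 1)%:R != 0 :> R by rewrite pnatr_eq0; case: (2 * m - 1)%N on.
by field; rewrite n0 t0.
Qed.

(** Continuity at [0], where the chain rule through [t ^+ 2] does not apply: the chosen [d]
    satisfies [(d ^+ 2) ^ (m / (2m - 1)) = e]. *)
Lemma root_pow_lt m e : (0 < m)%N -> 0 < e -> exists2 d, 0 < d &
  forall t, `|t| < d -> root_pow m (2 * m) t < e.
Proof.
move=> m0 e0; have on := odd_2m1 m0.
have n0 : (2 * m - 1)%:R != 0 :> R by rewrite pnatr_eq0; case: (2 * m - 1)%N on.
have mR : m%:R != 0 :> R by rewrite pnatr_eq0 -lt0n.
have p0 : 0 < (m%:R / (2 * m - 1)%:R : R).
  by rewrite divr_gt0// lt0r ?mR ?n0/=.
exists (Num.sqrt (e `^ (m%:R / (2 * m - 1)%:R)^-1)).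
  by rewrite sqrtr_gt0 powR_gt0.
move=> t td; rewrite root_pow_powR//.
have -> : e = (e `^ (m%:R / (2 * m - 1)%:R)^-1) `^ (m%:R / (2 * m - 1)%:R).
  by rewrite -powRrM mulVf ?powRr1 ?(ltW e0)// gt_eqF.
apply: gt0_ltr_powR; rewrite ?nnegrE ?sqr_ge0 ?powR_ge0//.
by rewrite -real_normK ?num_real// -[ltRHS]sqr_sqrtr ?powR_ge0// ltrXn2r.
Qed.

Lemma continuous_root_pow m : (0 < m)%N ->
  continuous (root_pow m (2 * m) : R -> R).
Proof.
move=> m0 t; have [->|t0] := eqVneq t 0; last first.
  have [d _] := is_derive_root_pow m0 t0.
  exact/differentiable_continuous/derivable1_diffP.
have w0 : root_pow m (2 * m) 0 = 0 :> R.
  by rewrite /root_pow /odd_root sgr0 mul0r expr0n muln_eq0/= gtn_eqF.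
apply/cvgrPdist_lt => e e0; rewrite w0.
have [d d0 dP] := root_pow_lt m0 e0.
exists d => //= s; rewrite /ball_/= !sub0r !normrN => sd.
by rewrite ger0_norm ?root_pow_ge0//; apply: dP.
Qed.
End OddRoot.

(** * Smoothness in two variables *)

Section Smooth2.
Context {R : realType}.
Implicit Types (I J : set R) (F G : R -> R -> R) (a : R -> R).

Section Ext.
Context {V : normedModType R}.
Implicit Types A B : R -> R -> V.

Lemma Ck2_on_cont k I J A : Ck2_on k I J A -> forall u v, I u -> J v ->
  {for (u, v), continuous (fun p => A p.1 p.2)}.
Proof. by case: k => [|k] []. Qed.

Lemma Ck2_on_le k I J A : Ck2_on k.+1 I J A -> Ck2_on k I J A.
Proof.
elim: k A => [|k IH] A; first by case.
by move=> [cA [dA A1 A2]]; exact: (conj cA (And3 dA (IH _ A1) (IH _ A2))).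
Qed.

Lemma near_fst I J u v : open I -> open J -> I u -> J v ->
  \forall p \near (u, v), I p.1 /\ J p.2.
Proof.
move=> oI oJ Iu Jv.
near=> p; split; near: p.
- by apply: (@cvg_fst _ _ (nbhs u) (nbhs v)); apply: open_nbhs_nbhs.
- by apply: (@cvg_snd _ _ (nbhs u) (nbhs v)); apply: open_nbhs_nbhs.
Unshelve. all: by end_near. Qed.

Lemma eq_derive1 I (a b : R -> V) t : open I -> I t ->
  (forall s, I s -> a s = b s) -> derive1 a t = derive1 b t.
Proof.
move=> oI It ab; rewrite !derive1E; apply: near_eq_derive.
by near=> s; apply: ab; near: s; apply: open_nbhs_nbhs.
Unshelve. all: by end_near. Qed.

Lemma eq_derivable I (a b : R -> V) t : open I -> I t ->
  (forall s, I s -> a s = b s) -> derivable a t 1 -> derivable b t 1.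
Proof.
move=> oI It ab; apply: near_eq_derivable.
by near=> s; apply: ab; near: s; apply: open_nbhs_nbhs.
Unshelve. all: by end_near. Qed.

(** Continuity and partial derivatives only depend on nearby values. The closure lemmas use this to
    replace a partial derivative by a formula valid on [I] and [J] only. *)
Lemma eq_Ck2_on k I J A B : open I -> open J ->
  (forall u v, I u -> J v -> A u v = B u v) -> Ck2_on k I J A -> Ck2_on k I J B.
Proof.
move=> oI oJ; elim: k A B => [|k IH] A B AB CA.
  split=> // u v Iu Jv; rewrite /prop_for /continuous_at -(AB _ _ Iu Jv).
  have := Ck2_on_cont CA Iu Jv; apply: cvg_trans; apply: near_eq_cvg.
  by have := near_fst oI oJ Iu Jv; apply: filterS => p [Ip Jp]; rewrite AB.
have [cA [dA A1 A2]] := CA; split.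
  move=> u v Iu Jv; rewrite /prop_for /continuous_at -(AB _ _ Iu Jv).
  have := cA _ _ Iu Jv; apply: cvg_trans; apply: near_eq_cvg.
  by have := near_fst oI oJ Iu Jv; apply: filterS => p [Ip Jp]; rewrite AB.
split.
- move=> u v Iu Jv; have [d1 d2] := dA _ _ Iu Jv; split.
    by apply: eq_derivable d1; [exact: oI|exact: Iu|move=> s Is; exact: AB].
  by apply: eq_derivable d2; [exact: oJ|exact: Jv|move=> s Is; exact: AB].
- apply: IH A1 => u v Iu Jv; apply: (eq_derive1 oI) => // s Is; exact: AB.
- apply: IH A2 => u v Iu Jv; apply: (eq_derive1 oJ) => // s Is; exact: AB.
Qed.
End Ext.

(** * Closure properties of the classes C^k *)

Variables I J : set R.
Hypotheses (oI : open I) (oJ : open J).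

Lemma Ck2_on_cst k (c : R) : Ck2_on k I J (fun _ _ => c).
Proof.
elim: k c => [|k IH] c; first by split=> // u v _ _; exact: cvg_cst.
split; first by move=> u v _ _; exact: cvg_cst.
split; first by move=> u v _ _; split; exact: derivable_cst.
- apply: eq_Ck2_on (IH 0) => // u v _ _.
  by rewrite /partial1 derive1_cst.
- apply: eq_Ck2_on (IH 0) => // u v _ _.
  by rewrite /partial2 derive1_cst.
Qed.

Lemma Ck2_onD k F G : Ck2_on k I J F -> Ck2_on k I J G ->
  Ck2_on k I J (fun u v => F u v + G u v).
Proof.
elim: k F G => [|k IH] F G CF CG.
  split=> // u v Iu Jv.
  by apply: cvgD; [exact: (Ck2_on_cont CF)|exact: (Ck2_on_cont CG)].
have [cF [dF F1 F2]] := CF; have [cG [dG G1 G2]] := CG; split.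
  by move=> u v Iu Jv; apply: cvgD; [exact: cF|exact: cG].
split.
- move=> u v Iu Jv; have [? ?] := dF _ _ Iu Jv; have [? ?] := dG _ _ Iu Jv.
  by split; apply: derivableD.
- apply: eq_Ck2_on (IH _ _ F1 G1) => // u v Iu Jv.
  have [d1 _] := dF _ _ Iu Jv; have [e1 _] := dG _ _ Iu Jv.
  rewrite /partial1 !derive1E.
  exact: (esym (@deriveD R R R (F^~ v) (G^~ v) u 1 d1 e1)).
- apply: eq_Ck2_on (IH _ _ F2 G2) => // u v Iu Jv.
  have [_ d2] := dF _ _ Iu Jv; have [_ e2] := dG _ _ Iu Jv.
  rewrite /partial2 !derive1E.
  exact: (esym (@deriveD R R R (F u) (G u) v 1 d2 e2)).
Qed.

Lemma derivableM_fun (a b : R -> R) t : derivable a t 1 ->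
  derivable b t 1 -> derivable (fun s => a s * b s) t 1.
Proof. by move=> da db; exact: (@derivableM R R a b t 1 da db). Qed.

Lemma derive1M_fun (a b : R -> R) t : derivable a t 1 -> derivable b t 1 ->
  derive1 (fun s => a s * b s) t = a t * derive1 b t + b t * derive1 a t.
Proof. by move=> da db; rewrite !derive1E; exact: (@deriveM R R a b t 1 da db). Qed.

Lemma Ck2_onM k F G : Ck2_on k I J F -> Ck2_on k I J G ->
  Ck2_on k I J (fun u v => F u v * G u v).
Proof.
elim: k F G => [|k IH] F G CF CG.
  split=> // u v Iu Jv.
  by apply: cvgM; [exact: (Ck2_on_cont CF)|exact: (Ck2_on_cont CG)].
have [cF [dF F1 F2]] := CF; have [cG [dG G1 G2]] := CG; split.
  by move=> u v Iu Jv; apply: cvgM; [exact: cF|exact: cG].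
(* The product rule multiplies a derivative of class [k] by an undifferentiated factor, which has to
   be lowered to the same class. *)
have CF' := Ck2_on_le CF; have CG' := Ck2_on_le CG.
split.
- move=> u v Iu Jv; have [? ?] := dF _ _ Iu Jv; have [? ?] := dG _ _ Iu Jv.
  by split; exact: derivableM_fun.
- apply: eq_Ck2_on (Ck2_onD (IH _ _ CF' G1) (IH _ _ CG' F1)) => // u v Iu Jv.
  have [d1 d2] := dF _ _ Iu Jv; have [e1 e2] := dG _ _ Iu Jv.
  exact: (esym (derive1M_fun d1 e1)).
- apply: eq_Ck2_on (Ck2_onD (IH _ _ CF' G2) (IH _ _ CG' F2)) => // u v Iu Jv.
  have [d1 d2] := dF _ _ Iu Jv; have [e1 e2] := dG _ _ Iu Jv.
  exact: (esym (derive1M_fun d2 e2)).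
Qed.

Lemma Ck2_onX k F n : Ck2_on k I J F -> Ck2_on k I J (fun u v => F u v ^+ n).
Proof.
move=> CF; elim: n => [|n IH].
  by apply: eq_Ck2_on (Ck2_on_cst k 1) => // u v _ _; rewrite expr0.
by apply: eq_Ck2_on (Ck2_onM CF IH) => // u v _ _; rewrite exprS.
Qed.

Lemma continuous_powR (c x : R) : 0 < x -> {for x, continuous (fun y => y `^ c)}.
Proof.
move=> x0; have [d _] := is_derive1_powR c x0.
exact/differentiable_continuous/derivable1_diffP.
Qed.

Lemma is_derive_powR (a : R -> R) t c : 0 < a t -> derivable a t 1 ->
  is_derive t (1 : R) (fun s => a s `^ c) (c * a t `^ (c - 1) * derive1 a t).
Proof.
move=> a0 /derivableP; rewrite -derive1E => da.
exact: (is_derive1_comp (is_derive1_powR c a0)).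
Qed.

Lemma Ck2_on_powR k F (c : R) : (forall u v, I u -> J v -> 0 < F u v) ->
  Ck2_on k I J F -> Ck2_on k I J (fun u v => F u v `^ c).
Proof.
(* The exponent is generalized because differentiation lowers it by one. *)
move=> F0; elim: k c => [|k IH] c CF.
  split=> // u v Iu Jv.
  apply: (@continuous_comp _ _ _ (fun p => F p.1 p.2) (fun y => y `^ c)).
    exact: (Ck2_on_cont CF).
  by apply: continuous_powR; exact: F0.
have [cF [dF F1 F2]] := CF; split.
  move=> u v Iu Jv.
  apply: (@continuous_comp _ _ _ (fun p => F p.1 p.2) (fun y => y `^ c)).
    exact: cF.
  by apply: continuous_powR; exact: F0.
have CF' := Ck2_on_le CF.
split.
- move=> u v Iu Jv; have [d1 d2] := dF _ _ Iu Jv.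
  by split; [have [] := is_derive_powR c (F0 _ _ Iu Jv) d1|
             have [] := is_derive_powR c (F0 _ _ Iu Jv) d2].
- apply: eq_Ck2_on (Ck2_onM (Ck2_onM (Ck2_on_cst k c) (IH (c - 1) CF')) F1) => // u v Iu Jv.
  have [d1 d2] := dF _ _ Iu Jv.
  have [_ ] := is_derive_powR c (F0 _ _ Iu Jv) d1.
  by rewrite -derive1E => <-.
- apply: eq_Ck2_on (Ck2_onM (Ck2_onM (Ck2_on_cst k c) (IH (c - 1) CF')) F2) => // u v Iu Jv.
  have [d1 d2] := dF _ _ Iu Jv.
  have [_ ] := is_derive_powR c (F0 _ _ Iu Jv) d2.
  by rewrite -derive1E => <-.
Qed.

Lemma smooth_on_derive1 K a : smooth_on K a -> smooth_on K (derive1 a).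
Proof. by move=> sa n t Kt; rewrite -derive1Sn; exact: sa. Qed.

Lemma derivable1_continuous a t : derivable a t 1 -> {for t, continuous a}.
Proof. by move=> ?; exact/differentiable_continuous/derivable1_diffP. Qed.

Lemma Ck2_on_fst k a : smooth_on I a -> Ck2_on k I J (fun u _ => a u).
Proof.
elim: k a => [|k IH] a sa.
  split=> // u v Iu Jv; apply: (@continuous_comp _ _ _ fst a); first exact: cvg_fst.
  exact/derivable1_continuous/(sa 0).
split.
  move=> u v Iu Jv; apply: (@continuous_comp _ _ _ fst a); first exact: cvg_fst.
  exact/derivable1_continuous/(sa 0).
split.
- by move=> u v Iu Jv; split; [exact: (sa 0)|exact: derivable_cst].
- exact/IH/smooth_on_derive1.
- apply: eq_Ck2_on (Ck2_on_cst k 0) => // u v _ _.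
  by rewrite /partial2 derive1_cst.
Qed.

Lemma Ck2_on_snd k a : smooth_on J a -> Ck2_on k I J (fun _ v => a v).
Proof.
elim: k a => [|k IH] a sa.
  split=> // u v Iu Jv; apply: (@continuous_comp _ _ _ snd a); first exact: cvg_snd.
  exact/derivable1_continuous/(sa 0).
split.
  move=> u v Iu Jv; apply: (@continuous_comp _ _ _ snd a); first exact: cvg_snd.
  exact/derivable1_continuous/(sa 0).
split.
- by move=> u v Iu Jv; split; [exact: derivable_cst|exact: (sa 0)].
- apply: eq_Ck2_on (Ck2_on_cst k 0) => // u v _ _.
  by rewrite /partial1 derive1_cst.
- exact/IH/smooth_on_derive1.
Qed.

(** With [Ck2_on_fst] this makes one-variable smoothness a special case of the two-variable notion,
    so that the closure lemmas serve for both. *)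
Lemma smooth2_on_fst a v : J v -> smooth2_on I J (fun u _ => a u) -> smooth_on I a.
Proof.
move=> Jv sa n; elim: n a sa => [|n IH] a sa u Iu.
  have [_ [d1 _ _]] := sa 1%N; exact: (d1 _ _ Iu Jv).1.
rewrite derive1Sn; apply: IH => // k.
have [_ [_ s1 _]] := sa k.+1; exact: s1.
Qed.


(** * Vector-valued maps, coordinate by coordinate *)

Lemma derivable_row3 (a b c : R -> R) t :
  derivable a t 1 -> derivable b t 1 -> derivable c t 1 ->
  derivable (fun s => row3 (a s) (b s) (c s)) t 1 /\
  derive1 (fun s => row3 (a s) (b s) (c s)) t =
    row3 (derive1 a t) (derive1 b t) (derive1 c t).
Proof.
move=> da db dc.
have H (i : 'I_1) (j : 'I_3) :
    (fun s => row3 (a s) (b s) (c s) i j) = [:: a; b; c]`_j.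
  by apply/funext => s; rewrite mxE; case: j => -[|[|[|//]]].
have dr : derivable (fun s => row3 (a s) (b s) (c s)) t 1.
  apply/derivable_mxP => i j; rewrite H.
  case: j => -[|[|[|?]]] lt_j3; [exact: da|exact: db|exact: dc|].
  discriminate lt_j3.
split; first exact: dr.
rewrite derive1E (derive_mx dr); apply/matrixP => i j.
by rewrite !mxE H !derive1E; case: j => -[|[|[|?]]].
Qed.

Lemma continuous_row3 (T : topologicalType) (x : T) (a b c : T -> R) :
  {for x, continuous a} -> {for x, continuous b} -> {for x, continuous c} ->
  {for x, continuous (fun y => row3 (a y) (b y) (c y))}.
Proof.
move=> ca cb cc; apply/cvgrPdist_lt => e e0.
have /cvgrPdist_lt/(_ _ e0) na := ca; have /cvgrPdist_lt/(_ _ e0) nb := cb.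
have /cvgrPdist_lt/(_ _ e0) nc := cc.
apply: filterS3 na nb nc => y ya yb yc.
rewrite [ltLHS]/Num.Def.normr/= mx_normrE; apply/bigmax_ltP; split=> // -[i j] _.
by rewrite !mxE; case: j => -[|[|[|?]]].
Qed.

Lemma Ck2_on_row3 k F G H : Ck2_on k I J F -> Ck2_on k I J G -> Ck2_on k I J H ->
  Ck2_on k I J (fun u v => row3 (F u v) (G u v) (H u v)).
Proof.
elim: k F G H => [|k IH] F G H CF CG CH.
  split=> // u v Iu Jv; apply: continuous_row3;
    [exact: (Ck2_on_cont CF)|exact: (Ck2_on_cont CG)|exact: (Ck2_on_cont CH)].
have [cF [dF F1 F2]] := CF; have [cG [dG G1 G2]] := CG.
have [cH [dH H1 H2]] := CH; split.
  by move=> u v Iu Jv; apply: continuous_row3; [exact: cF|exact: cG|exact: cH].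
split.
- move=> u v Iu Jv; have [f1 f2] := dF _ _ Iu Jv.
  have [g1 g2] := dG _ _ Iu Jv; have [h1 h2] := dH _ _ Iu Jv.
  by split; [exact: (derivable_row3 f1 g1 h1).1|exact: (derivable_row3 f2 g2 h2).1].
- apply: eq_Ck2_on (IH _ _ _ F1 G1 H1) => // u v Iu Jv.
  have [f1 f2] := dF _ _ Iu Jv.
  have [g1 g2] := dG _ _ Iu Jv; have [h1 h2] := dH _ _ Iu Jv.
  exact: (esym (derivable_row3 f1 g1 h1).2).
- apply: eq_Ck2_on (IH _ _ _ F2 G2 H2) => // u v Iu Jv.
  have [f1 f2] := dF _ _ Iu Jv.
  have [g1 g2] := dG _ _ Iu Jv; have [h1 h2] := dH _ _ Iu Jv.
  exact: (esym (derivable_row3 f2 g2 h2).2).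
Qed.
End Smooth2.

(** * Graphs *)

Section Geometry.
Context {R : realType}.
Implicit Types (I J : set R) (g h : R -> R) (N : R -> R -> 'rV[R]_3).

Lemma row3E0 (a b c : R) i : row3 a b c i 0 = a.
Proof. by rewrite mxE. Qed.

Lemma row3E1 (a b c : R) i : row3 a b c i 1 = b.
Proof. by rewrite mxE. Qed.

Lemma row3E2 (a b c : R) i : row3 a b c i 2 = c.
Proof. by rewrite mxE. Qed.

Definition row3E := (row3E0, row3E1, row3E2).

Lemma ord3E : ((inord 0 : 'I_3) = 0) * ((inord 1 : 'I_3) = 1) * ((inord 2 : 'I_3) = 2).
Proof. by split; [split|]; apply/val_inj; rewrite /= inordK. Qed.

Lemma sum3E (V : nmodType) (F : 'I_3 -> V) : \sum_i F i = F 0 + F 1 + F 2.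
Proof.
rewrite !big_ord_recr big_ord0 /= add0r.
by congr (F _ + F _ + F _); apply/val_inj.
Qed.

Lemma rv3P (x y : 'rV[R]_3) :
  x 0 0 = y 0 0 -> x 0 1 = y 0 1 -> x 0 2 = y 0 2 -> x = y.
Proof.
move=> e0 e1 e2; apply/rowP => -[[|[|[|//]]] lt_j3].
- by move: e0; congr (x 0 _ = y 0 _); apply/val_inj.
- by move: e1; congr (x 0 _ = y 0 _); apply/val_inj.
- by move: e2; congr (x 0 _ = y 0 _); apply/val_inj.
Qed.

Lemma crossprod_graph (a b : R) :
  crossprod (row3 1 0 a) (row3 0 1 b) = row3 (- a) (- b) 1.
Proof. by rewrite /crossprod /= !ord3E !row3E; congr row3; ring. Qed.

Lemma is_derive_coord (q w : 'rV[R]_3) i :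
  is_derive q w (fun x : 'rV[R]_3 => x 0 i) (w 0 i).
Proof.
have di : derivable (@id 'rV[R]_3) q w by exact: derivable_id.
split; first exact: ((derivable_mxP _ _ _).1 di 0 i).
by have := derive_mx di; rewrite derive_id => /rowP/(_ i); rewrite mxE => <-.
Qed.

Lemma derive_Phi m (q w : 'rV[R]_3) :
  'D_w (Phi m) q = \sum_i (2 * m)%:R * q 0 i ^+ (2 * m - 1) * w 0 i.
Proof.
have -> : Phi m = \sum_i ((fun x : 'rV[R]_3 => x 0 i) ^+ (2 * m)).
  by apply/funext => x; rewrite fct_sumE; apply: eq_bigr => i _; rewrite exprfctE.
have d i : is_derive q w ((fun x : 'rV[R]_3 => x 0 i) ^+ (2 * m)) 
    ((2 * m)%:R * q 0 i ^+ (2 * m - 1) * w 0 i).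
  by have := is_deriveX (2 * m) (is_derive_coord q w i); rewrite subn1.
by have [_ ->] := is_derive_sum d.
Qed.

Lemma grad_Phi m (q : 'rV[R]_3) :
  grad (Phi m) q = \row_i ((2 * m)%:R * q 0 i ^+ (2 * m - 1)).
Proof.
apply/rowP => j; rewrite !mxE derive_Phi (bigD1 j)//= big1.
  by rewrite addr0 mxE !eqxx mulr1.
by move=> i ij; rewrite mxE (negbTE ij) andbF mulr0.
Qed.

Lemma partial1_homothetical g h u v : derivable g u 1 ->
  partial1 (homothetical g h) u v = row3 1 0 (derive1 g u * h v).
Proof.
move=> dg; rewrite /partial1 /homothetical.
have dgh : derivable (fun s => g s * h v) u 1.
  by apply: derivableM_fun; [exact: dg|exact: derivable_cst].
have [_ ->] := derivable_row3 (@derivable_id _ _ u 1) (derivable_cst v u 1) dgh.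
rewrite derive1_id derive1_cst; congr row3.
rewrite (derive1M_fun dg (derivable_cst _ _ _)) derive1_cst.
by rewrite mulr0 add0r mulrC.
Qed.

Lemma partial2_homothetical g h u v : derivable h v 1 ->
  partial2 (homothetical g h) u v = row3 0 1 (g u * derive1 h v).
Proof.
move=> dh; rewrite /partial2 /homothetical.
have dgh : derivable (fun s => g u * h s) v 1.
  by apply: derivableM_fun; [exact: derivable_cst|exact: dh].
have [_ ->] := derivable_row3 (derivable_cst u v 1) (@derivable_id _ _ v 1) dgh.
rewrite derive1_id derive1_cst; congr row3.
rewrite (derive1M_fun (derivable_cst _ _ _) dh) derive1_cst.
by rewrite mulr0 addr0.
Qed.

Lemma row3_mul_tr (a b c d e f : R) :
  row3 a b c *m (row3 d e f)^T = (a * d + b * e + c * f)%:M.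
Proof.
by rewrite [LHS]mx11_scalar !mxE sum3E !mxE /= .
Qed.

Lemma graph_frame_free (a b : R) :
  row_free (col_mx (row3 1 0 a) (row3 0 1 b)).
Proof.
apply/row_freeP; exists (row_mx (row3 1 0 0)^T (row3 0 1 0)^T).
rewrite mul_col_row !row3_mul_tr !(mulr0, mul0r, mulr1, addr0, add0r).
by rewrite -[LHS]/(block_mx _ _ _ _) raddf0 -scalar_mx_block.
Qed.

Lemma scale_row3 (k a b c : R) : k *: row3 a b c = row3 (k * a) (k * b) (k * c).
Proof. by apply: rv3P; rewrite mxE !row3E. Qed.

Lemma add_row3 (a b c d e f : R) :
  row3 a b c + row3 d e f = row3 (a + d) (b + e) (c + f).
Proof. by apply: rv3P; rewrite mxE !row3E. Qed.

(** The first two columns of the frame form the identity, so the coefficients of a tangent vector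
    are its first two coordinates. These coefficients form the matrix whose trace is taken. *)
Lemma trace_graph_frame (a b a1 a2 b1 b2 : R) :
  \tr (col_mx (row3 a1 a2 (a1 * a + a2 * b)) (row3 b1 b2 (b1 * a + b2 * b))
         *m pinvmx (col_mx (row3 1 0 a) (row3 0 1 b))) = a1 + b2.
Proof.
set X := col_mx (row3 1 0 a) _.
have -> : col_mx (row3 a1 a2 (a1 * a + a2 * b)) (row3 b1 b2 (b1 * a + b2 * b)) =
    block_mx a1%:M a2%:M b1%:M b2%:M *m X.
  rewrite mul_block_col !mul_scalar_mx !scale_row3 !add_row3.
  by congr col_mx; congr row3; ring.
by rewrite mulmxKp ?graph_frame_free// mxtrace_block !mxtrace_scalar.
Qed.

Lemma sub_graph_frame (a b : R) (w : 'rV[R]_3) :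
  (w <= col_mx (row3 1 0 a) (row3 0 1 b))%MS <->
  w 0 2 = w 0 0 * a + w 0 1 * b.
Proof.
split.
  move=> /submxP[D ->]; rewrite -[D]hsubmxK mul_row_col.
  rewrite [lsubmx D]mx11_scalar [rsubmx D]mx11_scalar !mul_scalar_mx.
  by rewrite !scale_row3 add_row3 !row3E; ring.
move=> e; apply/submxP; exists (row_mx (w 0 0)%:M (w 0 1)%:M).
rewrite mul_row_col !mul_scalar_mx !scale_row3 add_row3.
by apply: rv3P; rewrite !row3E ?e; ring.
Qed.

End Geometry.

(** * The minimal surface equation *)

Section MeanCurvature.
Context {R : realType}.
Implicit Types (I J : set R) (g h : R -> R) (N : R -> R -> 'rV[R]_3).

(* [P] and [Q] stand for the powers [(2m-2)/(2m-1)] of [fu] and [fv]. *)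
Definition graph_equation (P Q fu fv fuu fuv fvv : R) :=
  fuu * (Q + fv ^+ 2) + fvv * (P + fu ^+ 2) = 2 * fu * fv * fuv.

(** The arguments stand for the values of [g], [h] and their first two derivatives at a point; in
    this form rescaling and exchanging the factors is plain algebra. *)
Definition homothetical_equation m (g0 g1 g2 h0 h1 h2 : R) :=
  graph_equation (root_pow m (2 * m - 2) (g1 * h0))
    (root_pow m (2 * m - 2) (g0 * h1))
    (g1 * h0) (g0 * h1) (g2 * h0) (g1 * h1) (g0 * h2).

Lemma is_derive1P (a : R -> R) t : derivable a t 1 ->
  is_derive t (1 : R) a (derive1 a t).
Proof. by rewrite derive1E => /derivableP. Qed.

Lemma is_derive1X (a : R -> R) n t da : is_derive t (1 : R) a da ->
  is_derive t (1 : R) (fun s => a s ^+ n) (n%:R * a t ^+ n.-1 * da).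
Proof. by move=> d; have := @is_deriveX R R a n t 1 da d; rewrite exprfctE. Qed.

Lemma is_derive1M (a b : R -> R) t da db : is_derive t (1 : R) a da ->
  is_derive t (1 : R) b db ->
  is_derive t (1 : R) (fun s => a s * b s) (a t * db + b t * da).
Proof. by move=> d e; exact: (@is_deriveM R R a b t 1 da db d e). Qed.

Lemma is_derive1_eq_on I (a b : R -> R) t da db : open I -> I t ->
  is_derive t (1 : R) a da -> is_derive t (1 : R) b db ->
  (forall s, I s -> a s = b s) -> da = db.
Proof.
move=> oI It [_ <-] [_ <-] ab; rewrite -!derive1E.
exact: (eq_derive1 oI It ab).
Qed.

(** Implicit differentiation of the relation between one of the first two coordinates of the normal
    ([x]), the last one ([z]) and a partial derivative of the graph function ([y]). *)
Lemma derive_power_relation I (x y z : R -> R) n t : open I -> I t ->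
  derivable x t 1 -> derivable y t 1 -> derivable z t 1 ->
  (forall s, I s -> x s ^+ n = - (y s * z s ^+ n)) ->
  n%:R * x t ^+ n.-1 * derive1 x t =
    - (derive1 y t * z t ^+ n + y t * (n%:R * z t ^+ n.-1 * derive1 z t)).
Proof.
move=> oI It /is_derive1P dx /is_derive1P dy /is_derive1P dz e.
have dr := is_deriveN (is_derive1M dy (is_derive1X n dz)).
rewrite (is_derive1_eq_on oI It (is_derive1X n dx) dr e).
by rewrite addrC [_ * derive1 y t]mulrC.
Qed.

Lemma derive_sphere_relation I (x y z : R -> R) n t : open I -> I t -> (0 < n)%N ->
  derivable x t 1 -> derivable y t 1 -> derivable z t 1 ->
  (forall s, I s -> x s ^+ n + y s ^+ n + z s ^+ n = 1) ->
  x t ^+ n.-1 * derive1 x t + y t ^+ n.-1 * derive1 y t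
    + z t ^+ n.-1 * derive1 z t = 0.
Proof.
move=> oI It n0 /is_derive1P dx /is_derive1P dy /is_derive1P dz e.
have dl := is_deriveD (is_deriveD (is_derive1X n dx) (is_derive1X n dy))
  (is_derive1X n dz).
have := is_derive1_eq_on oI It dl (is_derive_cst (1 : R) t (1 : R)) e.
rewrite -!mulrA -!mulrDr => /eqP; rewrite mulf_eq0 pnatr_eq0 gtn_eqF//=.
by move/eqP.
Qed.

(** Here [M] is [2m - 1], [z] is the third coordinate of the normal, and the [a]'s and [b]'s are the
    derivatives of its coordinates in [u] and in [v]. Solving the linear relations for [a3] and [b3]
    brings in the positive factor [T]; the trace is then a nonzero multiple of the difference of the
    two sides of the graph equation. *)
Lemma graph_equation_trace (M z P Q fu fv fuu fuv fvv a1 a2 a3 b1 b2 b3 : R) :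
  M != 0 -> z != 0 -> 0 < P -> 0 < Q ->
  M * P * a1 = - (fuu * z + fu * (M * a3)) ->
  M * P * b1 = - (fuv * z + fu * (M * b3)) ->
  M * Q * a2 = - (fuv * z + fv * (M * a3)) ->
  M * Q * b2 = - (fvv * z + fv * (M * b3)) ->
  a3 = fu * a1 + fv * a2 -> b3 = fu * b1 + fv * b2 ->
  a1 + b2 = 0 <-> graph_equation P Q fu fv fuu fuv fvv.
Proof.
move=> M0 z0 P0 Q0 e1 e2 e3 e4 e5 e6.
pose T := P * Q + fu ^+ 2 * Q + fv ^+ 2 * P.
have T0 : 0 < T.
  by rewrite /T -addrA ltr_pwDl ?mulr_gt0// addr_ge0// mulr_ge0 ?sqr_ge0// ltW.
(* Eliminates [a1] and [a2] from the tangency relation [e5]. *)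
have k1 : M * a3 * T = - z * (fu * Q * fuu + fv * P * fuv).
  have : M * a3 * (P * Q) = fu * Q * (M * P * a1) + fv * P * (M * Q * a2).
    by rewrite [in LHS]e5; ring.
  rewrite e1 e3 /T => k; rewrite -addrA mulrDr k; ring.
have k2 : M * b3 * T = - z * (fu * Q * fuv + fv * P * fvv).
  have : M * b3 * (P * Q) = fu * Q * (M * P * b1) + fv * P * (M * Q * b2).
    by rewrite [in LHS]e6; ring.
  rewrite e2 e4 /T => k; rewrite -addrA mulrDr k; ring.
have k3 : M * P * Q * T * (a1 + b2) =
    - z * P * Q * (fuu * (Q + fv ^+ 2) + fvv * (P + fu ^+ 2) - 2 * fu * fv * fuv).
  transitivity (Q * T * (M * P * a1) + P * T * (M * Q * b2)); first by ring.
  rewrite e1 e4.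
  transitivity (- (Q * T * fuu * z + Q * fu * (M * a3 * T)
                  + P * T * fvv * z + P * fv * (M * b3 * T))); first by ring.
  by rewrite k1 k2 /T; ring.
have c0 : M * P * Q * T != 0 by rewrite !mulf_neq0 // gt_eqF.
have d0 : - z * P * Q != 0 by rewrite !mulf_neq0 ?oppr_eq0 // gt_eqF.
split=> [e|/eqP].
  apply/eqP; rewrite -subr_eq0; move: k3; rewrite e mulr0 => /esym/eqP.
  by rewrite mulf_eq0 (negbTE d0).
rewrite -subr_eq0 => /eqP e; move: k3; rewrite e mulr0 => /eqP.
by rewrite mulf_eq0 (negbTE c0) => /eqP.
Qed.

(** Taking roots, [x] is [- odd_root (2 * m - 1) f * z], and the even exponent [2 * m - 2] removes
    the sign. *)
Lemma root_pow_normal m (x z f : R) : (0 < m)%N -> z != 0 ->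
  x ^+ (2 * m - 1) = - (f * z ^+ (2 * m - 1)) ->
  x ^+ (2 * m - 2) = root_pow m (2 * m - 2) f * z ^+ (2 * m - 2).
Proof.
move=> m0 z0 e.
have -> : x = - odd_root (2 * m - 1) f * z.
  rewrite -(odd_root_exprK x (odd_2m1 m0)) e -mulNr odd_rootM.
  by rewrite odd_root_exprK ?odd_2m1// /odd_root sgrN normrN mulNr.
have -> : (2 * m - 2 = 2 * (m - 1))%N by lia.
by rewrite exprMn /root_pow [X in X * _]exprM sqrrN -exprM.
Qed.

(** The gradient condition is read in coordinates, the cross product being [(- f_u, - f_v, 1)]. Its
    third coordinate determines [phi], which is then eliminated; as [phi > 0] and the exponent is
    odd, the third coordinate of the normal is positive. *)
Lemma birkhoff_gauss_powers m I J g h N u v : (0 < m)%N ->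
  smooth_on I g -> smooth_on J h ->
  birkhoff_gauss m I J (homothetical g h) N -> I u -> J v ->
  [/\ 0 < N u v 0 2,
     N u v 0 0 ^+ (2 * m - 1) = - (derive1 g u * h v * N u v 0 2 ^+ (2 * m - 1)) &
     N u v 0 1 ^+ (2 * m - 1) = - (g u * derive1 h v * N u v 0 2 ^+ (2 * m - 1))].
Proof.
move=> m0 sg sh [_ gN] Iu Jv; have [_ _ [phi phi0]] := gN _ _ Iu Jv.
rewrite grad_Phi partial1_homothetical ?partial2_homothetical; last 2 first.
- exact: (sh 0).
- exact: (sg 0).
rewrite crossprod_graph scale_row3 => /rowP e.
have := e 0; have := e 1; have := e 2; rewrite !row3E !mxE => e2 e1 e0 {e}.
have M0 : 0 < (2 * m)%:R :> R by rewrite ltr0n muln_gt0.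
move: M0 e0 e1 e2; set c := (2 * m)%:R; move: c => c M0 e0 e1 e2.
have E2 : N u v 0 2 ^+ (2 * m - 1) = phi / c.
  by apply: (mulfI (lt0r_neq0 M0)); rewrite e2; field; rewrite lt0r_neq0.
split.
- have : 0 < N u v 0 2 ^+ (2 * m - 1) by rewrite E2 divr_gt0.
  by rewrite exprn_odd_gt0 ?odd_2m1.
- by apply: (mulfI (lt0r_neq0 M0)); rewrite e0 E2; field; rewrite lt0r_neq0.
- by apply: (mulfI (lt0r_neq0 M0)); rewrite e1 E2; field; rewrite lt0r_neq0.
Qed.

Lemma smooth2_on_derivable I J (N : R -> R -> 'rV[R]_3) u v :
  smooth2_on I J N -> I u -> J v ->
  derivable (N^~ v) u 1 /\ derivable (N u) v 1.
Proof. by move=> sN Iu Jv; have [_ [dN _ _]] := sN 1%N; exact: dN. Qed.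

Lemma derive1_rV3 (F : R -> 'rV[R]_3) t : derivable F t 1 ->
  (forall j, derivable (fun s => F s 0 j) t 1) /\
  derive1 F t = row3 (derive1 (fun s => F s 0 0) t)
    (derive1 (fun s => F s 0 1) t) (derive1 (fun s => F s 0 2) t).
Proof.
move=> dF; split; first by move=> j; exact: ((derivable_mxP _ _ _).1 dF 0 j).
by rewrite !derive1E (derive_mx dF); apply: rv3P; rewrite mxE row3E.
Qed.

Lemma mean_curvature_eq0 m I J g h N u v : (1 < m)%N -> open I -> open J ->
  smooth_on I g -> smooth_on J h ->
  (forall u, I u -> g u != 0 /\ derive1 g u != 0) ->
  (forall v, J v -> h v != 0 /\ derive1 h v != 0) ->
  birkhoff_gauss m I J (homothetical g h) N -> I u -> J v ->
  mean_curvature (homothetical g h) N u v = 0 <->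
  homothetical_equation m (g u) (derive1 g u) (derive1 (derive1 g) u)
    (h v) (derive1 h v) (derive1 (derive1 h) v).
Proof.
move=> m1 oI oJ sg sh g0 h0 bN Iu Jv.
have m0 : (0 < m)%N by exact: ltnW.
have [gu0 g'u0] := g0 _ Iu; have [hv0 h'v0] := h0 _ Jv.
have pw s t (Is : I s) (Jt : J t) := birkhoff_gauss_powers m0 sg sh bN Is Jt.
have [sN gN] := bN.
have [dNu dNv] := smooth2_on_derivable sN Iu Jv.
have [dNu' eNu] := derive1_rV3 dNu; have [dNv' eNv] := derive1_rV3 dNv.
have dg : derivable g u 1 by exact: (sg 0).
have dg' : derivable (derive1 g) u 1 by exact: (sg 1%N).
have dh : derivable h v 1 by exact: (sh 0).
have dh' : derivable (derive1 h) v 1 by exact: (sh 1%N).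
have sph s t : I s -> J t ->
    N s t 0 0 ^+ (2 * m) + N s t 0 1 ^+ (2 * m) + N s t 0 2 ^+ (2 * m) = 1.
  by move=> Is Jt; have [+ _ _] := gN _ _ Is Jt; rewrite /unit_sphere/= /Phi sum3E.
have [z0 p0 p1] := pw _ _ Iu Jv.
have n0 : (0 < 2 * m)%N by rewrite muln_gt0.
have dfu (k : R -> R) (c t : R) : derivable k t 1 -> derivable (fun s => k s * c) t 1.
  by move=> dk; apply: derivableM_fun; [exact: dk|exact: derivable_cst].
have dfu' (k : R -> R) (c t : R) : derivable k t 1 ->
    derive1 (fun s => k s * c) t = derive1 k t * c.
  move=> dk; rewrite (derive1M_fun dk (derivable_cst _ _ _)) derive1_cst.
  by rewrite mulr0 add0r mulrC.
have dfv (k : R -> R) (c t : R) : derivable k t 1 -> derivable (fun s => c * k s) t 1.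
  by move=> dk; apply: derivableM_fun; [exact: derivable_cst|exact: dk].
have dfv' (k : R -> R) (c t : R) : derivable k t 1 ->
    derive1 (fun s => c * k s) t = c * derive1 k t.
  move=> dk; rewrite (derive1M_fun (derivable_cst _ _ _) dk) derive1_cst.
  by rewrite mulr0 addr0.
pose M := (2 * m - 1)%N.
have M0 : M%:R != 0 :> R by rewrite pnatr_eq0 -lt0n odd_gt0 ?odd_2m1.
(* The power relations are differentiated in [u] and in [v]: [r1] and [r2] for the first coordinate,
   [r3] and [r4] for the second. *)
have r1 := @derive_power_relation I (fun s => N s v 0 0)
  (fun s => derive1 g s * h v) (fun s => N s v 0 2) M u oI Iu (dNu' 0)
  (dfu _ _ _ dg') (dNu' 2)
  (fun s Is => let: And3 _ e _ := pw s v Is Jv in e).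
have r2 := @derive_power_relation J (fun s => N u s 0 0)
  (fun s => derive1 g u * h s) (fun s => N u s 0 2) M v oJ Jv (dNv' 0)
  (dfv _ _ _ dh) (dNv' 2)
  (fun s Js => let: And3 _ e _ := pw u s Iu Js in e).
have r3 := @derive_power_relation I (fun s => N s v 0 1)
  (fun s => g s * derive1 h v) (fun s => N s v 0 2) M u oI Iu (dNu' 1)
  (dfu _ _ _ dg) (dNu' 2)
  (fun s Is => let: And3 _ _ e := pw s v Is Jv in e).
have r4 := @derive_power_relation J (fun s => N u s 0 1)
  (fun s => g u * derive1 h s) (fun s => N u s 0 2) M v oJ Jv (dNv' 1)
  (dfv _ _ _ dh') (dNv' 2)
  (fun s Js => let: And3 _ _ e := pw u s Iu Js in e).
have s1 := derive_sphere_relation oI Iu n0 (dNu' 0) (dNu' 1) (dNu' 2)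
  (fun s Is => sph s v Is Jv).
have s2 := derive_sphere_relation oJ Jv n0 (dNv' 0) (dNv' 1) (dNv' 2)
  (fun s Js => sph u s Iu Js).
rewrite (dfu' _ _ _ dg') in r1; rewrite (dfv' _ _ _ dh) in r2.
rewrite (dfu' _ _ _ dg) in r3; rewrite (dfv' _ _ _ dh') in r4.
cbv beta in r1, r2, r3, r4, s1, s2.
rewrite -subn1 p0 p1 in s1; rewrite -subn1 p0 p1 in s2.
have zz0 : N u v 0 2 != 0 by rewrite gt_eqF.
have q0 := root_pow_normal m0 zz0 p0; have q1 := root_pow_normal m0 zz0 p1.
have eM : M.-1 = (2 * m - 2)%N by rewrite /M; lia.
have eM' : N u v 0 2 ^+ M = N u v 0 2 * N u v 0 2 ^+ (2 * m - 2).
  by rewrite -exprS; congr (_ ^+ _); rewrite /M; lia.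
rewrite eM eM' q0 in r1; rewrite eM eM' q0 in r2.
rewrite eM eM' q1 in r3; rewrite eM eM' q1 in r4.
have Z0 : N u v 0 2 ^+ (2 * m - 2) != 0 by rewrite expf_neq0.
have Z1 : N u v 0 2 ^+ M != 0 by rewrite expf_neq0.
rewrite -/M in s1 s2.
move: eNu eNv r1 r2 r3 r4 s1 s2 Z0 Z1.
set a1 := derive1 (fun s => N s v 0 0) u.
set a2 := derive1 (fun s => N s v 0 1) u.
set a3 := derive1 (fun s => N s v 0 2) u.
set b1 := derive1 (fun s => N u s 0 0) v.
set b2 := derive1 (fun s => N u s 0 1) v.
set b3 := derive1 (fun s => N u s 0 2) v.
set z := N u v 0 2.
set Z := z ^+ _; set Z' := z ^+ M.
set P := root_pow m _ _; set Q := root_pow m _ _.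
move=> eNu eNv r1 r2 r3 r4 s1 s2 Z0 Z1.
(* By the differentiated equation of the sphere, the derivatives of the normal are tangent to the
   graph; this gives [d eta] a matrix in the frame. *)
have e5 : a3 = derive1 g u * h v * a1 + g u * derive1 h v * a2.
  by apply: (mulfI Z1); apply/eqP; rewrite -subr_eq0 -s1; apply/eqP; ring.
have e6 : b3 = derive1 g u * h v * b1 + g u * derive1 h v * b2.
  by apply: (mulfI Z1); apply/eqP; rewrite -subr_eq0 -s2; apply/eqP; ring.
rewrite /mean_curvature /frame (partial1_homothetical h v dg).
rewrite (partial2_homothetical g u dh).
rewrite /partial1 /partial2 eNu eNv e5 e6.
have -> : derive1 g u * h v * a1 + g u * derive1 h v * a2 =
  a1 * (derive1 g u * h v) + a2 * (g u * derive1 h v) by ring.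
have -> : derive1 g u * h v * b1 + g u * derive1 h v * b2 =
  b1 * (derive1 g u * h v) + b2 * (g u * derive1 h v) by ring.
rewrite trace_graph_frame.
have -> : 2^-1 * (a1 + b2) = 0 <-> a1 + b2 = 0.
  by split=> [/eqP|->]; rewrite ?mulr0// mulf_eq0 invr_eq0 pnatr_eq0 /= => /eqP.
have PP : 0 < P by rewrite root_pow2m2_gt0// mulf_neq0.
have QQ : 0 < Q by rewrite root_pow2m2_gt0// mulf_neq0.
have swap (c x : R) : M%:R * c * x * Z = M%:R * (c * Z) * x by ring.
apply: (graph_equation_trace M0 (zz0 : z != 0) PP QQ _ _ _ _ e5 e6).
- by apply: (mulIf Z0); rewrite swap r1; ring.
- by apply: (mulIf Z0); rewrite swap r2; ring.
- by apply: (mulIf Z0); rewrite swap r3; ring.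
- by apply: (mulIf Z0); rewrite swap r4; ring.
Qed.

End MeanCurvature.

(** * Existence of the Birkhoff-Gauss map *)

Section Existence.
Context {R : realType}.
Implicit Types (I J : set R) (g h : R -> R).

(** As [F ^+ 2] is positive, the sign-free form of the root reduces the claim to products and real
    powers. *)
Lemma Ck2_on_odd_root I J k n (F : R -> R -> R) : open I -> open J ->
  (forall u v, I u -> J v -> F u v != 0) ->
  Ck2_on k I J F -> Ck2_on k I J (fun u v => odd_root n (F u v)).
Proof.
move=> oI oJ F0 CF.
have F2 u v : I u -> J v -> 0 < F u v ^+ 2.
  by move=> Iu Jv; rewrite exprn_even_gt0//= F0.
have C := Ck2_onM oI oJ CF
  (Ck2_on_powR oI oJ ((n%:R^-1 - 1) / 2) F2 (Ck2_onX oI oJ 2 CF)).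
by apply: eq_Ck2_on C => // u v _ _; rewrite -odd_root_powR.
Qed.

(** The gradient condition prescribes the direction [(- p, - q, 1)] of the normal up to a positive
    factor, and [n] normalizes it. The roots [p] and [q] are smooth because [f_u] and [f_v] do not
    vanish. *)
Lemma birkhoff_gauss_exists m I J g h : (1 < m)%N -> open I -> open J ->
  smooth_on I g -> smooth_on J h ->
  (forall u, I u -> g u != 0 /\ derive1 g u != 0) ->
  (forall v, J v -> h v != 0 /\ derive1 h v != 0) ->
  exists N, birkhoff_gauss m I J (homothetical g h) N.
Proof.
move=> m1 oI oJ sg sh g0 h0; have m0 : (0 < m)%N by exact: ltnW.
pose fu u v := derive1 g u * h v; pose fv u v := g u * derive1 h v.
pose p u v := odd_root (2 * m - 1) (fu u v).
pose q u v := odd_root (2 * m - 1) (fv u v).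
pose W u v := p u v ^+ (2 * m) + q u v ^+ (2 * m) + 1.
pose n u v := W u v `^ (- (2 * m)%:R^-1).
have W0 u v : 0 < W u v.
  by rewrite /W ltr_wpDl// addr_ge0// exprn_even_ge0// mul2n odd_double.
have n0 u v : 0 < n u v by rewrite powR_gt0.
have fu0 u v : I u -> J v -> fu u v != 0.
  by move=> /g0[_ ?] /h0[? _]; rewrite mulf_neq0.
have fv0 u v : I u -> J v -> fv u v != 0.
  by move=> /g0[? _] /h0[_ ?]; rewrite mulf_neq0.
have Cfu k : Ck2_on k I J fu.
  apply: (Ck2_onM oI oJ); first exact: (Ck2_on_fst oI oJ _ (smooth_on_derive1 sg)).
  exact: (Ck2_on_snd oI oJ).
have Cfv k : Ck2_on k I J fv.
  apply: (Ck2_onM oI oJ); first exact: (Ck2_on_fst oI oJ).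
  exact: (Ck2_on_snd oI oJ _ (smooth_on_derive1 sh)).
have Cp k : Ck2_on k I J p := Ck2_on_odd_root (2 * m - 1) oI oJ fu0 (Cfu k).
have Cq k : Ck2_on k I J q := Ck2_on_odd_root (2 * m - 1) oI oJ fv0 (Cfv k).
have CW k : Ck2_on k I J W.
  apply: (Ck2_onD oI oJ); last exact: (Ck2_on_cst oI oJ).
  by apply: (Ck2_onD oI oJ); apply: (Ck2_onX oI oJ); [exact: Cp|exact: Cq].
have Cn k : Ck2_on k I J n := Ck2_on_powR oI oJ _ (fun u v _ _ => W0 u v) (CW k).
(* With [- 1 *] in front, the first two coordinates are products of functions already known to be
   smooth. *)
exists (fun u v => row3 (- 1 * p u v * n u v) (- 1 * q u v * n u v) (n u v)).
split.
  move=> k; apply: (Ck2_on_row3 oI oJ _ _ (Cn k)).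
    apply: (Ck2_onM oI oJ _ (Cn k)); apply: (Ck2_onM oI oJ _ (Cp k)).
    exact: (Ck2_on_cst oI oJ).
  apply: (Ck2_onM oI oJ _ (Cn k)); apply: (Ck2_onM oI oJ _ (Cq k)).
  exact: (Ck2_on_cst oI oJ).
move=> u v Iu Jv; set N := row3 _ _ _.
have on := odd_2m1 m0.
have c0 : 0 < (2 * m)%:R :> R by rewrite ltr0n muln_gt0.
have nW : n u v ^+ (2 * m) * W u v = 1.
  rewrite -powR_mulrn ?powR_ge0// /n -powRrM mulNr mulVf ?lt0r_neq0//.
  by rewrite powR_inv1 ?ltW// mulVf// lt0r_neq0.
have even_pow (x y : R) :
    (- 1 * x * y) ^+ (2 * m) = x ^+ (2 * m) * y ^+ (2 * m).
  by rewrite !exprMn exprM sqrrN !expr1n mul1r.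
have odd_pow (x y : R) :
    (- 1 * x * y) ^+ (2 * m - 1) = - x ^+ (2 * m - 1) * y ^+ (2 * m - 1).
  by rewrite !exprMn -signr_odd on expr1 mulN1r.
have sN : unit_sphere m N.
  rewrite /unit_sphere/= /Phi sum3E /N !row3E !even_pow -[RHS]nW /W.
  by rewrite mulrDr mulr1 mulrDr !(mulrC (n u v ^+ _)).
have N0 : N 0 0 ^+ (2 * m - 1) = - (fu u v) * n u v ^+ (2 * m - 1).
  by rewrite /N row3E odd_pow odd_rootK.
have N1 : N 0 1 ^+ (2 * m - 1) = - (fv u v) * n u v ^+ (2 * m - 1).
  by rewrite /N row3E odd_pow odd_rootK.
have N2 : N 0 2 = n u v by rewrite /N row3E.
have dg : derivable g u 1 by exact: (sg 0).
have dh : derivable h v 1 by exact: (sh 0).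
have gradN : grad (Phi m) N =
    ((2 * m)%:R * n u v ^+ (2 * m - 1)) *: row3 (- fu u v) (- fv u v) 1.
  rewrite grad_Phi scale_row3; apply: rv3P; rewrite mxE row3E ?N0 ?N1 ?N2.
  - by rewrite mulrCA mulrC.
  - by rewrite mulrCA mulrC.
  - by rewrite mulr1.
split.
- exact: sN.
- split.
    apply/eqP => /rowP/(_ 2); rewrite N2 mxE => /eqP.
    by rewrite gt_eqF.
  have -> : norm2m m N = 1 by rewrite /norm2m (sN : Phi m N = 1) powR1.
  (* Both planes are kernels of proportional linear forms: the derivative of [Phi m] along [w] is
     [2m n^(2m - 1)] times [w_3 - f_u w_1 - f_v w_2]. *)
  rewrite invr1 scale1r; apply/seteqP; split=> w; rewrite /tangent_plane /sphere_tangent /=.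
    rewrite /frame (partial1_homothetical h v dg) (partial2_homothetical g u dh).
    rewrite derive_Phi sum3E N0 N1 N2 => e; apply/sub_graph_frame.
    apply/eqP; rewrite -subr_eq0; apply/eqP.
    have c : (2 * m)%:R * n u v ^+ (2 * m - 1) != 0.
      by rewrite mulf_neq0 ?lt0r_neq0// exprn_gt0.
    by apply: (mulfI c); rewrite mulr0 -[RHS]e /fu /fv; ring.
  rewrite /frame (partial1_homothetical h v dg) (partial2_homothetical g u dh).
  move=> /sub_graph_frame e.
  by rewrite derive_Phi sum3E N0 N1 N2 e /fu /fv; ring.
- exists ((2 * m)%:R * n u v ^+ (2 * m - 1)); first by rewrite mulr_gt0// exprn_gt0.
  by rewrite gradN (partial1_homothetical h v dg) (partial2_homothetical g u dh)
    crossprod_graph.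
Qed.
End Existence.

(** * Separation of variables *)

Section Separation.
Context {R : realType}.
Implicit Types (I J : set R) (g h : R -> R).

(** This symmetry reduces the case [h'' = 0] to the case [g'' = 0]. *)
Lemma homothetical_equationC m (g0 g1 g2 h0 h1 h2 : R) :
  homothetical_equation m g0 g1 g2 h0 h1 h2 ->
  homothetical_equation m h0 h1 h2 g0 g1 g2.
Proof.
rewrite /homothetical_equation /graph_equation.
rewrite ![h1 * _]mulrC ![h0 * _]mulrC ![h2 * _]mulrC => e.
by rewrite addrC e; ring.
Qed.

(** The two factors of the third coordinate are determined only up to a constant, which this moves
    from one to the other. *)
Lemma homothetical_equation_scale m (c g0 g1 g2 h0 h1 h2 : R) :
  homothetical_equation m g0 g1 g2 (c * h0) (c * h1) (c * h2) =
  homothetical_equation m (g0 * c) (g1 * c) (g2 * c) h0 h1 h2.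
Proof. by rewrite /homothetical_equation !mulrA. Qed.

(** Once the powers of exponent [2 * m - 2] are written as [t ^+ 2 / w t] with [w] multiplicative,
    the difference of the two sides is [g0 * h0 * g1 ^+ 2 * h1 ^+ 2] times the separated one. *)
Lemma homothetical_equation_sep m (g0 g1 g2 h0 h1 h2 : R) : (0 < m)%N ->
  g0 != 0 -> g1 != 0 -> h0 != 0 -> h1 != 0 ->
  homothetical_equation m g0 g1 g2 h0 h1 h2 <->
  g2 * g0 / g1 ^+ 2 *
    (1 + (root_pow m (2 * m) g0)^-1 * (root_pow m (2 * m) h1)^-1) +
  h2 * h0 / h1 ^+ 2 *
    (1 + (root_pow m (2 * m) g1)^-1 * (root_pow m (2 * m) h0)^-1) = 2.
Proof.
move=> m0 g00 g10 h00 h10.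
rewrite /homothetical_equation /graph_equation !root_pow2m2E ?mulf_neq0//.
rewrite !root_powM.
move: (root_pow_gt0 m0 g00) (root_pow_gt0 m0 g10).
move: (root_pow_gt0 m0 h00) (root_pow_gt0 m0 h10).
set x := root_pow _ _ g0; set y := root_pow _ _ g1.
set z := root_pow _ _ h0; set w := root_pow _ _ h1.
move=> /lt0r_neq0 z0 /lt0r_neq0 w0 /lt0r_neq0 x0 /lt0r_neq0 y0.
have c0 : g0 * h0 * g1 ^+ 2 * h1 ^+ 2 != 0 by rewrite !mulf_neq0 ?expf_neq0.
set L := (X in X = _ <-> _); set S := (X in _ <-> X = _); set r := (X in _ = X <-> _).
have e : L - r = g0 * h0 * g1 ^+ 2 * h1 ^+ 2 * (S - 2).
  by rewrite /L /r /S; field; rewrite x0 y0 z0 w0 g10 h10.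
split=> [/eqP|/eqP]; rewrite -subr_eq0 => /eqP E; apply/eqP; rewrite -subr_eq0.
  by move: e; rewrite E => /esym/eqP; rewrite mulf_eq0 (negbTE c0).
by rewrite e E mulr0.
Qed.

(* Mixed differences of the identity kill the summands depending on a single
   variable. *)
Lemma affine_separation (T U : Type) (I : set T) (J : set U)
    (B G E : T -> R) (F C H : U -> R) u1 u2 v1 v2 :
  (forall u v, I u -> J v ->
    B u * (1 + G u * C v) + F v * (1 + E u * H v) = 2) ->
  I u1 -> I u2 -> E u1 != E u2 -> J v1 -> J v2 -> C v1 != C v2 ->
  exists la mu nu ka : R,
    (forall u, I u -> B u * G u = la * E u + mu /\ B u = ka - nu * E u) /\
    (forall v, J v -> F v * H v = nu - la * C v /\ F v = (2 - ka) - mu * C v).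
Proof.
move=> eq Iu1 Iu2 E12 Jv1 Jv2 C12.
have dE : E u2 - E u1 != 0 by rewrite subr_eq0 eq_sym.
have dC : C v2 - C v1 != 0 by rewrite subr_eq0 eq_sym.
pose A u := B u * G u; pose D v := F v * H v.
have mixed u u' v v' : I u -> I u' -> J v -> J v' ->
    (A u - A u') * (C v - C v') + (E u - E u') * (D v - D v') = 0.
  move=> Iu Iu' Jv Jv'.
  transitivity ((B u * (1 + G u * C v) + F v * (1 + E u * H v))
    - (B u * (1 + G u * C v') + F v' * (1 + E u * H v'))
    - (B u' * (1 + G u' * C v) + F v * (1 + E u' * H v))
    + (B u' * (1 + G u' * C v') + F v' * (1 + E u' * H v'))).
    by rewrite /A /D; ring.
  by rewrite !eq//; ring.
(* [la] is the slope of [A] against [E] between [u1] and [u2], which the mixed differences carry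
   over to all points; [nu], [mu] and [ka] are intercepts read off at [u1] and [v1]. *)
pose la := (A u2 - A u1) / (E u2 - E u1).
pose nu := D v1 + la * C v1; pose mu := A u1 - la * E u1.
pose ka := B u1 + nu * E u1.
have dA : A u2 - A u1 = la * (E u2 - E u1) by rewrite /la divfK.
have eD v : J v -> D v = nu - la * C v.
  move=> Jv; apply: (mulfI dE); apply/eqP; rewrite -subr_eq0.
  rewrite -[X in _ == X](mixed _ _ _ _ Iu2 Iu1 Jv Jv1) dA /nu.
  by apply/eqP; ring.
have eA u : I u -> A u = la * E u + mu.
  move=> Iu; apply: (mulfI dC); apply/eqP; rewrite -subr_eq0.
  rewrite -[X in _ == X](mixed _ _ _ _ Iu Iu1 Jv2 Jv1) !eD// /mu.
  by apply/eqP; ring.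
have eB u v : I u -> J v -> B u + nu * E u + mu * C v + F v = 2.
  move=> Iu Jv; rewrite -(eq _ _ Iu Jv).
  transitivity (B u + (la * E u + mu) * C v + F v + E u * (nu - la * C v)).
    by ring.
  by rewrite -eA// -eD// /A /D; ring.
exists la, mu, nu, ka; split=> [u Iu|v Jv].
  split; first exact: eA.
  apply/eqP; rewrite -subr_eq0 -[X in _ == X](subrr (2 : R)).
  rewrite -[X in _ == X - _](eB _ _ Iu Jv1) -[X in _ == _ - X](eB _ _ Iu1 Jv1).
  by rewrite /ka; apply/eqP; ring.
split; first exact: eD.
by rewrite -(eB _ _ Iu1 Jv) /ka; ring.
Qed.

(** The logarithmic derivative is a constant multiple of that of [a]. Applied to [g] and to [g'],
    this yields [E' / E = B G' / G]. *)
Lemma is_derive_root_powV m (a : R -> R) t : (0 < m)%N -> a t != 0 ->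
  derivable a t 1 ->
  is_derive t (1 : R) (fun s => (root_pow m (2 * m) (a s))^-1)
    (- ((2 * m)%:R / (2 * m - 1)%:R) * (root_pow m (2 * m) (a t))^-1
       * (derive1 a t / a t)).
Proof.
move=> m0 at0 /is_derive1P da.
have wt := root_pow_gt0 m0 at0.
have dw : is_derive t (1 : R) (fun s => root_pow m (2 * m) (a s)) _ :=
  is_derive1_comp (is_derive_root_pow m0 at0) da.
have := is_deriveV (lt0r_neq0 wt : (fun s => root_pow m (2 * m) (a s)) t != 0) dw.
move=> d; apply: is_derive_eq d _; rewrite /GRing.scale/=.
move: wt => /lt0r_neq0; move: (root_pow _ _ _) => x x0.
have n0 : (2 * m - 1)%:R != 0 :> R by rewrite pnatr_eq0 -lt0n odd_gt0 ?odd_2m1.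
by move: n0; move: (2 * m - 1)%:R (2 * m)%:R => y z y0; field; rewrite x0 y0 at0.
Qed.

Lemma exponent_neq0 m : (0 < m)%N -> (2 * m)%:R / (2 * m - 1)%:R != 0 :> R.
Proof.
move=> m0; rewrite mulf_neq0 ?invr_eq0 ?pnatr_eq0 ?muln_eq0 -?lt0n//.
by rewrite odd_gt0 ?odd_2m1.
Qed.

Lemma root_pow_nonconstant m I (a : R -> R) t : (0 < m)%N -> open I -> I t ->
  a t != 0 -> derivable a t 1 -> derive1 a t != 0 ->
  exists2 s, I s & (root_pow m (2 * m) (a t))^-1 != (root_pow m (2 * m) (a s))^-1.
Proof.
move=> m0 oI It at0 da a't0; apply: contrapT => cst.
have e s : I s -> (root_pow m (2 * m) (a s))^-1 = (root_pow m (2 * m) (a t))^-1.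
  by move=> Is; apply: contrapT => /eqP ne; apply: cst; exists s; rewrite // eq_sym.
have := is_derive1_eq_on oI It (is_derive_root_powV m0 at0 da)
  (is_derive_cst ((root_pow m (2 * m) (a t))^-1 : R) t (1 : R)) e.
move/eqP; apply/negP.
have wt := lt0r_neq0 (root_pow_gt0 m0 at0); have si0 := exponent_neq0 m0.
by rewrite mulf_neq0 ?mulf_neq0 ?oppr_eq0 ?invr_eq0.
Qed.

(* Writing [(ka - nu E) G = la E + mu] and using [E' / E = (ka - nu E) G' / G], the
   derivative of the first relation reads [(ka - nu E) ((1 - ka) G + mu) = 0];
   differentiating once more gives [ka = 1]. *)
Lemma power_separation m I g (la mu nu ka u : R) : (0 < m)%N -> open I ->
  smooth_on I g -> (forall u, I u -> g u != 0 /\ derive1 g u != 0) ->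
  (forall u, I u ->
     derive1 (derive1 g) u * g u / derive1 g u ^+ 2 * (root_pow m (2 * m) (g u))^-1 =
       la * (root_pow m (2 * m) (derive1 g u))^-1 + mu /\
     derive1 (derive1 g) u * g u / derive1 g u ^+ 2 =
       ka - nu * (root_pow m (2 * m) (derive1 g u))^-1) ->
  I u -> derive1 (derive1 g) u != 0 ->
  [/\ ka = 1, mu = 0 &
    (root_pow m (2 * m) (g u))^-1 =
      (la + nu * (root_pow m (2 * m) (g u))^-1)
        * (root_pow m (2 * m) (derive1 g u))^-1].
Proof.
move=> m0 oI sg g0 rel Iu g2.
pose G s := (root_pow m (2 * m) (g s))^-1.
pose E s := (root_pow m (2 * m) (derive1 g s))^-1.
pose si : R := (2 * m)%:R / (2 * m - 1)%:R.
have si0 : si != 0 := exponent_neq0 m0.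
have dG s : I s -> is_derive s (1 : R) G (- si * G s * (derive1 g s / g s)).
  move=> Is; apply: is_derive_root_powV => //; first exact: (g0 _ Is).1.
  exact: (sg 0).
have dE s : I s ->
    is_derive s (1 : R) E (- si * E s * (derive1 (derive1 g) s / derive1 g s)).
  move=> Is; apply: is_derive_root_powV => //; first exact: (g0 _ Is).2.
  exact: (sg 1%N).
have E0 s : I s -> E s != 0.
  by move=> Is; rewrite invr_eq0 lt0r_neq0// root_pow_gt0//; have [] := g0 _ Is.
have G0 s : I s -> G s != 0.
  by move=> Is; rewrite invr_eq0 lt0r_neq0// root_pow_gt0//; have [] := g0 _ Is.
pose B s := derive1 (derive1 g) s * g s / derive1 g s ^+ 2.
have relA s : I s -> (ka - nu * E s) * G s = la * E s + mu.
  by move=> Is; have [<- <-] := rel _ Is.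
have relB s : I s -> B s = ka - nu * E s by move=> Is; have [] := rel _ Is.
have dkE s : I s -> is_derive s (1 : R) (fun s => ka - nu * E s)
    (- (nu * (- si * E s * (derive1 (derive1 g) s / derive1 g s)))).
  move=> Is; have d := dE _ Is.
  have := is_deriveB (is_derive_cst (ka : R) s (1 : R))
    (is_derive1M (is_derive_cst (nu : R) s (1 : R)) d).
  by move=> d'; apply: is_derive_eq d' _; rewrite /cst; ring.
have prod0 s : I s -> (ka - nu * E s) * ((1 - ka) * G s + mu) = 0.
  move=> Is; have [gs0 g's0] := g0 _ Is.
  have dl := is_derive1M (dkE _ Is) (dG _ Is).
  have dr := is_deriveD (is_derive1M (is_derive_cst (la : R) s (1 : R)) (dE _ Is))
    (is_derive_cst (mu : R) s (1 : R)).
  have := is_derive1_eq_on oI Is dl dr relA.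
  rewrite /cst mulr0 !addr0.
  have -> : derive1 (derive1 g) s / derive1 g s = B s * (derive1 g s / g s).
    by rewrite /B; field; rewrite gs0 g's0.
  rewrite relB// => e.
  have c0 : si * (derive1 g s / g s) != 0.
    by rewrite mulf_neq0// mulf_neq0// invr_eq0.
  have e' := etrans (congr1 (fun x => x - _) e) (subrr _).
  have r : la * E s + mu - (ka - nu * E s) * G s = 0 by rewrite relA// subrr.
  apply: (mulfI c0); rewrite mulr0.
  (* The negated derivative of [relA], plus a multiple of [relA] itself, eliminates [la]. *)
  have /= := congr2 (fun x y => - x + si * (derive1 g s / g s) * (ka - nu * E s) * y) e' r.
  rewrite [X in _ = X](_ : _ = 0); last by ring.
  by move=> <-; ring.
have B0 : ka - nu * E u != 0.
  rewrite -relB// /B; have [gu0 g'u0] := g0 _ Iu.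
  by rewrite !mulf_neq0// invr_eq0 expf_neq0.
have f0 : (1 - ka) * G u + mu = 0.
  by have /eqP := prod0 _ Iu; rewrite mulf_eq0 (negbTE B0) => /eqP.
have dF : is_derive u (1 : R) (fun s => (1 - ka) * G s + mu)
    ((1 - ka) * (- si * G u * (derive1 g u / g u))).
  have := is_deriveD (is_derive1M (is_derive_cst (1 - ka : R) u (1 : R)) (dG _ Iu))
    (is_derive_cst (mu : R) u (1 : R)).
  by move=> d'; apply: is_derive_eq d' _; rewrite /cst; ring.
(* Since [(1 - ka) * G + mu] vanishes at [u], the derivative of [prod0] there reduces to
   [ka - nu * E] times the derivative of that factor, which forces [ka = 1]. *)
have := is_derive1_eq_on oI Iu (is_derive1M (dkE _ Iu) dF)
  (is_derive_cst (0 : R) u (1 : R)) prod0.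
rewrite f0 mul0r addr0 => /eqP; rewrite mulf_eq0 (negbTE B0)/=.
have [gu0 g'u0] := g0 _ Iu.
have c0 : - si * G u * (derive1 g u / g u) != 0.
  by rewrite !mulf_neq0 ?oppr_eq0 ?G0// invr_eq0.
rewrite mulf_eq0 (negbTE c0) orbF subr_eq0 => /eqP ka1.
have mu0 : mu = 0 by move: f0; rewrite -ka1 subrr mul0r add0r.
split=> //.
have := relA _ Iu; rewrite mu0 addr0 -ka1 -/(G u) -/(E u) => e.
by rewrite mulrDl -e; ring.
Qed.

(** If both second derivatives were nonzero somewhere, neither [E] nor [C] would be constant, and
    [power_separation], applied to [g] and to [h], would make both [la] and [- la] positive. *)
Lemma homothetical_equation_split m I J g h : (0 < m)%N -> open I -> open J ->
  smooth_on I g -> smooth_on J h ->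
  (forall u, I u -> g u != 0 /\ derive1 g u != 0) ->
  (forall v, J v -> h v != 0 /\ derive1 h v != 0) ->
  (forall u v, I u -> J v ->
    homothetical_equation m (g u) (derive1 g u) (derive1 (derive1 g) u)
      (h v) (derive1 h v) (derive1 (derive1 h) v)) ->
  (forall u, I u -> derive1 (derive1 g) u = 0) \/
  (forall v, J v -> derive1 (derive1 h) v = 0).
Proof.
move=> m0 oI oJ sg sh g0 h0 eq.
apply: contrapT => /not_orP[/existsNP[u /not_implyP[Iu /eqP g2]]].
move=> /existsNP[v /not_implyP[Jv /eqP h2]].
have [u' Iu' ne_u] := root_pow_nonconstant m0 oI Iu (g0 _ Iu).2 (sg 1%N _ Iu) g2.
have [v' Jv' ne_v] := root_pow_nonconstant m0 oJ Jv (h0 _ Jv).2 (sh 1%N _ Jv) h2.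
have sep s t : I s -> J t -> _ := fun Is Jt =>
  (homothetical_equation_sep _ _ m0 (g0 _ Is).1 (g0 _ Is).2 (h0 _ Jt).1 (h0 _ Jt).2).1
    (eq _ _ Is Jt).
have [la [mu [nu [ka [relu relv]]]]] :=
  affine_separation (B := fun s => derive1 (derive1 g) s * g s / derive1 g s ^+ 2)
    (G := fun s => (root_pow m (2 * m) (g s))^-1)
    (E := fun s => (root_pow m (2 * m) (derive1 g s))^-1)
    (F := fun t => derive1 (derive1 h) t * h t / derive1 h t ^+ 2)
    (C := fun t => (root_pow m (2 * m) (derive1 h t))^-1)
    (H := fun t => (root_pow m (2 * m) (h t))^-1)
    sep Iu Iu' ne_u Jv Jv' ne_v.
have [ka1 mu0 eu] := power_separation m0 oI sg g0 relu Iu g2.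
(* The relations for [h] are those for [g] with [la], [mu], [nu], [ka] replaced by [- la], [nu],
   [mu], [2 - ka]; the second application therefore supplies [nu = 0]. *)
have relv' t : J t ->
   derive1 (derive1 h) t * h t / derive1 h t ^+ 2 * (root_pow m (2 * m) (h t))^-1 =
     - la * (root_pow m (2 * m) (derive1 h t))^-1 + nu /\
   derive1 (derive1 h) t * h t / derive1 h t ^+ 2 =
     2 - ka - mu * (root_pow m (2 * m) (derive1 h t))^-1.
  by move=> Jt; have [-> ->] := relv _ Jt; split=> //; ring.
have [_ nu0 ev] := power_separation m0 oJ sh h0 relv' Jv h2.
move: eu ev; rewrite mu0 nu0 !mul0r !addr0 => eu ev.
have wpos (x : R) : x != 0 -> 0 < (root_pow m (2 * m) x)^-1.
  by move=> x0; rewrite invr_gt0 root_pow_gt0.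
have [gu0 g'u0] := g0 _ Iu; have [hv0 h'v0] := h0 _ Jv.
have := wpos _ gu0; rewrite eu pmulr_lgt0 ?wpos// => la0.
have := wpos _ hv0; rewrite ev pmulr_lgt0 ?wpos// oppr_gt0.
by move/(lt_trans la0); rewrite ltxx.
Qed.

End Separation.

(** * The first integral and its quadrature *)

Section Ode.
Context {R : realType}.
Implicit Types (I J : set R) (f g h k : R -> R).

Lemma is_derive0_itv_cst I f x y : is_interval I ->
  (forall t, I t -> is_derive t (1 : R) f 0) -> I x -> I y -> f x = f y.
Proof.
move=> itvI df; wlog xy : x y / x <= y.
  by move=> H Ix Iy; have [xy|/ltW xy] := leP x y; [|apply/esym]; apply: H.
move=> Ix Iy.
have sub t : t \in `[x, y]%R -> I t.
  by rewrite in_itv/= => /andP[xt ty]; apply: (itvI _ _ Ix Iy); rewrite xt.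
have cf : {within `[x, y], continuous f}.
  by apply: derivable_within_continuous => t /sub/df[].
have dfi t : t \in `]x, y[%R -> is_derive t (1 : R) f ((fun=> 0) t).
  by move=> tI; apply: df; apply: sub; apply: subset_itv_oo_cc.
have [c _ /eqP] := MVT_segment xy dfi cf.
by rewrite mul0r subr_eq0 => /eqP.
Qed.

Lemma is_derive_neq0_inj f (df : R -> R) :
  (forall t, is_derive t (1 : R) f (df t)) -> (forall t, df t != 0) -> injective f.
Proof.
move=> dfE df0 x y; wlog xy : x y / x <= y.
  by move=> H fxy; have [xy|/ltW xy] := leP x y; [|apply/esym]; apply: H.
move=> fxy.
have cf : {within `[x, y], continuous f}.
  by apply: derivable_within_continuous => t _; have [] := dfE t.
have [c _ /eqP] := MVT_segment xy (fun t _ => dfE t) cf.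
by rewrite fxy subrr eq_sym mulf_eq0 (negbTE (df0 c))/= subr_eq0 => /eqP.
Qed.

Lemma continuous_antiderivative_gt f (a : R) : continuous f ->
  exists F : R -> R, forall s : R, a < s -> is_derive s (1 : R) F (f s).
Proof.
move=> cf; pose F s := (\int[lebesgue_measure]_(t in [set` `[a, s]]) f t)%R.
exists F => s as_.
have ss : s < s + 1 by rewrite ltrDl.
have intf : (@lebesgue_measure R).-integrable `[a, s + 1] (EFin \o f).
  apply: continuous_compact_integrable; first exact: segment_compact.
  exact: continuous_subspaceT.
have [dF eF] := continuous_FTC1_closed ss intf as_ (cf s).
by split; [exact: dF|rewrite -derive1E].
Qed.

(** Integrals of [f] and of its reflection, both starting at [-1], give antiderivatives on two
    overlapping half-lines. They differ by a constant on the overlap and can be glued. *)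
Lemma continuous_antiderivative f : continuous f ->
  exists F : R -> R, forall s : R, is_derive s (1 : R) F (f s).
Proof.
move=> cf; have [F dF] := continuous_antiderivative_gt (-1) cf.
have cfN : continuous (fun s => f (- s)).
  by move=> s; apply: continuous_comp; [exact: oppr_continuous|exact: cf].
have [G dG] := continuous_antiderivative_gt (-1) cfN.
have dH (s : R) : s < 1 -> is_derive s (1 : R) (fun s => - G (- s)) (f s).
  move=> s1; have sN : -1 < - s by rewrite ltrN2.
  have d := is_deriveN (is_derive1_comp (dG _ sN) (is_deriveNid s (1 : R))).
  by apply: is_derive_eq d _; rewrite opprK mulrN1 opprK.
(* This constant makes the two pieces agree at [0]. *)
pose c := F 0 + G 0.
have glue (s : R) : `]-1, 1[%classic s -> F s = - G (- s) + c.
  move=> s11; apply/eqP; rewrite -subr_eq0; apply/eqP.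
  have itv11 : is_interval [set` (`]-1, 1[ : interval R)] by exact: interval_is_interval.
  have d0 (t : R) : `]-1, 1[%classic t ->
      is_derive t (1 : R) (fun s => F s - (- G (- s) + c)) 0.
    rewrite /= in_itv/= => /andP[t1 t2].
    have d := is_deriveB (dF _ t1) (is_deriveD (dH _ t2) (is_derive_cst (c : R) t (1 : R))).
    by apply: is_derive_eq d _; rewrite addr0 subrr.
  rewrite (is_derive0_itv_cst itv11 d0 s11 (y := 0)) /= ?in_itv/= ?ltrN10 ?ltr01//.
  by rewrite oppr0 /c; ring.
exists (fun s => if -1 < s then F s else - G (- s) + c) => s.
have [s1|s1] := ltP (-1) s.
  have d := dF _ s1; apply: (near_eq_is_derive _ d).
  near=> t; rewrite ifT//; near: t; exact: lt_nbhsr.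
have s1' : s < 1 by apply: le_lt_trans s1 _; lra.
have d := is_deriveD (dH _ s1') (is_derive_cst (c : R) s (1 : R)).
rewrite addr0 in d; apply: (near_eq_is_derive _ d).
(* Only at [-1] can nearby points fall under the other formula, and there [glue] identifies the
   two. *)
near=> t; case: ifPn => // t1.
have t1' : t < 1 by near: t; exact: lt_nbhsl.
by rewrite glue//= in_itv/= t1.
Unshelve. all: by end_near. Qed.

(** * The integrand of [Psi] and the first integral *)

Definition psi_base m (a s : R) := root_pow m (2 * m - 2) a + a ^+ 2 * root_pow m (2 * m) s.

Lemma psi_base_gt0 m a s : (0 < m)%N -> a != 0 -> 0 < psi_base m a s.
Proof.
move=> m0 a0; rewrite /psi_base ltr_pwDl ?root_pow2m2_gt0// mulr_ge0 ?sqr_ge0//.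
exact: root_pow_ge0.
Qed.

Definition psi_integrand m (a c s : R) := c^-1 * (1 / psi_base m a s `^ ((2 * m - 1)%:R / m%:R)).

Lemma psi_integrandE m a c s :
  psi_integrand m a c s = c^-1 * psi_base m a s `^ (- ((2 * m - 1)%:R / m%:R)).
Proof. by rewrite /psi_integrand powRN div1r. Qed.

Lemma psi_integrand_neq0 m a c s : (0 < m)%N -> a != 0 -> c != 0 ->
  psi_integrand m a c s != 0.
Proof.
move=> m0 a0 c0; rewrite psi_integrandE mulf_neq0 ?invr_eq0// lt0r_neq0//.
by rewrite powR_gt0 ?psi_base_gt0.
Qed.

Lemma continuous_psi_integrand m a c : (0 < m)%N -> a != 0 ->
  continuous (psi_integrand m a c).
Proof.
move=> m0 a0 s.
have -> : psi_integrand m a c = fun s => c^-1 * psi_base m a s `^ (- ((2 * m - 1)%:R / m%:R)).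
  by apply/funext => t; rewrite psi_integrandE.
apply: (@continuousM R R (cst c^-1)
  (fun s => psi_base m a s `^ (- ((2 * m - 1)%:R / m%:R)))); first exact: cvg_cst.
apply: (@continuous_comp _ _ _ (psi_base m a) (fun y => y `^ (- ((2 * m - 1)%:R / m%:R)))).
  apply: (@continuousD R R R (cst (root_pow m (2 * m - 2) a))
    (fun s => a ^+ 2 * root_pow m (2 * m) s)); first exact: cvg_cst.
  apply: (@continuousM R R (cst (a ^+ 2)) (root_pow m (2 * m))); first exact: cvg_cst.
  exact: continuous_root_pow.
by apply: continuous_powR; exact: psi_base_gt0.
Qed.

(** The exponent times [2m / (2m - 1)] equals [-2]. Hence the derivative is a positive multiple of
    the left side of the differential equation satisfied by the second factor. *)
Lemma is_derive_first_integral m a k v : (0 < m)%N -> a != 0 ->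
  derivable k v 1 -> derivable (derive1 k) v 1 -> k v != 0 ->
  is_derive v (1 : R)
    (fun t => derive1 k t * psi_base m a (k t) `^ (- ((2 * m - 1)%:R / m%:R)))
    (psi_base m a (k v) `^ (- ((2 * m - 1)%:R / m%:R) - 1) *
      (derive1 (derive1 k) v * psi_base m a (k v)
        - 2 * a ^+ 2 * root_pow m (2 * m) (k v) * derive1 k v ^+ 2 / k v)).
Proof.
move=> m0 a0 /is_derive1P dk /is_derive1P dk' kv0.
have Qv := psi_base_gt0 (k v) m0 a0.
set p := - ((2 * m - 1)%:R / m%:R).
have dw : is_derive v (1 : R) (fun t => root_pow m (2 * m) (k t)) _ :=
  is_derive1_comp (is_derive_root_pow m0 kv0) dk.
have dQ : is_derive v (1 : R) (fun t => psi_base m a (k t)) _ :=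
  is_deriveD (is_derive_cst (root_pow m (2 * m - 2) a : R) v (1 : R))
    (is_derive1M (is_derive_cst (a ^+ 2 : R) v (1 : R)) dw).
have dQp : is_derive v (1 : R) (fun t => psi_base m a (k t) `^ p) _ :=
  is_derive1_comp (f := fun y => y `^ p) (g := fun t => psi_base m a (k t))
    (is_derive1_powR p Qv) dQ.
apply: is_derive_eq (is_derive1M dk' dQp) _.
have -> : psi_base m a (k v) `^ p = psi_base m a (k v) * psi_base m a (k v) `^ (p - 1).
  rewrite powRB ?(gt_eqF Qv) ?implybT// powRr1 ?ltW// mulrC divfK//.
  exact: lt0r_neq0.
move: (psi_base m a (k v) `^ (p - 1)) (root_pow m (2 * m) (k v)) => X w.
have mR : m%:R != 0 :> R by rewrite pnatr_eq0 -lt0n.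
have n0 : (2 * m - 1)%:R != 0 :> R by rewrite pnatr_eq0 -lt0n odd_gt0 ?odd_2m1.
rewrite /p /cst natrM; move: (2 * m - 1)%:R n0 => n n0.
by field; rewrite kv0 mR n0.
Qed.

(** With [g'' = 0] the value [g0] enters only through the nonzero factor [g0 * k0 ^+ 2 / w];
    dividing by it leaves an ordinary differential equation in [v]. *)
Lemma homothetical_equation_affine m (g0 a k0 k1 k2 : R) : (0 < m)%N ->
  g0 != 0 -> a != 0 -> k0 != 0 -> k1 != 0 ->
  homothetical_equation m g0 a 0 k0 k1 k2 <->
  k2 * psi_base m a k0 - 2 * a ^+ 2 * root_pow m (2 * m) k0 * k1 ^+ 2 / k0 = 0.
Proof.
move=> m0 g00 a0 k00 k10.
rewrite /homothetical_equation /graph_equation /psi_base !mul0r add0r root_powM.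
rewrite (root_pow2m2E m0 k00).
have := lt0r_neq0 (root_pow_gt0 m0 k00); move: (root_pow m (2 * m) k0) => w w0.
move: (root_pow m (2 * m - 2) a) => r.
have c0 : g0 * k0 ^+ 2 / w != 0 by rewrite !mulf_neq0 ?invr_eq0 ?expf_neq0.
set x := (X in X = _ <-> _); set y := (X in _ = X <-> _); set z := (X in _ <-> X = _).
have e : x - y = g0 * k0 ^+ 2 / w * z by rewrite /x /y /z; field; rewrite w0 k00.
split=> [E|E].
  by apply: (mulfI c0); rewrite -e E subrr mulr0.
by apply/eqP; rewrite -subr_eq0 e E mulr0.
Qed.

End Ode.

(** * Surfaces with an affine factor and the inverse of [Psi] *)

Section PsiData.
Context {R : realType}.
Implicit Types (I J : set R) (f g h k Psi Psi_inv : R -> R).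

Lemma affine_on I g : open I -> is_interval I -> I !=set0 -> smooth_on I g ->
  (forall u, I u -> derive1 (derive1 g) u = 0) ->
  exists a b : R, forall u, I u -> derive1 g u = a /\ g u = a * u + b.
Proof.
move=> oI itvI [u0 Iu0] sg g2.
have d1 u : I u -> derive1 g u = derive1 g u0.
  move=> Iu; apply: (is_derive0_itv_cst itvI _ Iu Iu0) => t It.
  by rewrite -(g2 _ It); apply: is_derive1P; exact: (sg 1%N).
exists (derive1 g u0), (g u0 - derive1 g u0 * u0) => u Iu.
split; first exact: d1.
have d0 t : I t -> is_derive t (1 : R) (fun s => g s - derive1 g u0 * s) 0.
  move=> It; have d := is_deriveB (is_derive1P (sg 0 _ It))
    (is_derive1M (is_derive_cst (derive1 g u0 : R) t (1 : R)) (is_derive_id t (1 : R))).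
  by apply: is_derive_eq d _; rewrite (d1 _ It) /cst mulr0 addr0 mulr1 subrr.
by rewrite -(is_derive0_itv_cst itvI d0 Iu Iu0); ring.
Qed.

(** The first integral has a constant value [c2], nonzero because [h'] is. Separating variables in
    it shows that [h] inverts an antiderivative of the integrand. *)
Lemma affine_factor_Psi_data m I J g h : (0 < m)%N ->
  open_interval I -> open_interval J -> smooth_on I g -> smooth_on J h ->
  (forall u, I u -> g u != 0 /\ derive1 g u != 0) ->
  (forall v, J v -> h v != 0 /\ derive1 h v != 0) ->
  (forall u v, I u -> J v ->
    homothetical_equation m (g u) (derive1 g u) (derive1 (derive1 g) u)
      (h v) (derive1 h v) (derive1 (derive1 h) v)) ->
  (forall u, I u -> derive1 (derive1 g) u = 0) ->
  exists (a b c2 : R) (Psi Psi_inv : R -> R),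
    Psi_data m J a c2 Psi Psi_inv /\
    (forall u v, I u -> J v -> g u * h v = (a * u + b) * Psi_inv v).
Proof.
move=> m0 [oI itvI I0] [oJ itvJ J0] sg sh g0 h0 eq g2.
have [a [b gE]] := affine_on oI itvI I0 sg g2.
have [u0 Iu0] := I0; have [v0 Jv0] := J0.
have [gu0 a0] := g0 _ Iu0; rewrite (gE _ Iu0).1 in a0.
pose p : R := - ((2 * m - 1)%:R / m%:R).
pose K (t : R) : R := derive1 h t * psi_base m a (h t) `^ p.
have dK t : J t -> is_derive t (1 : R) K 0.
  move=> Jt; have [ht0 h't0] := h0 _ Jt.
  have d := is_derive_first_integral m0 a0 (sh 0 _ Jt) (sh 1%N _ Jt) ht0.
  apply: is_derive_eq d _.
  have := eq _ _ Iu0 Jt; rewrite (g2 _ Iu0) (gE _ Iu0).1.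
  by move=> /(homothetical_equation_affine _ m0 gu0 a0 ht0 h't0) ->; rewrite mulr0.
pose c2 := K v0.
have c20 : c2 != 0.
  rewrite mulf_neq0 ?(h0 _ Jv0).2// lt0r_neq0// powR_gt0//.
  exact: psi_base_gt0.
have KE t : J t -> K t = c2.
  by move=> Jt; exact: (is_derive0_itv_cst itvJ dK Jt Jv0).
have [F dF] := continuous_antiderivative (continuous_psi_integrand (c := c2) m0 a0).
(* The added constant gives [Psi (h v0) = v0]. *)
pose Psi s := F s + (v0 - F (h v0)).
have dPsi s : is_derive s (1 : R) Psi (psi_integrand m a c2 s).
  have d := is_deriveD (dF s) (is_derive_cst (v0 - F (h v0) : R) s (1 : R)).
  by apply: is_derive_eq d _; rewrite addr0.
have Psi_inj : injective Psi.
  by apply: is_derive_neq0_inj dPsi _ => t; exact: psi_integrand_neq0.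
(* [0] is a dummy value outside the range of [Psi]. *)
pose Psi_inv t := xget 0 [set s | Psi s = t].
have PsiK : cancel Psi Psi_inv.
  move=> s; apply: Psi_inj.
  exact: (xgetPex 0 (ex_intro (fun s' => Psi s' = Psi s) s erefl)).
have Psih v : J v -> Psi (h v) = v.
  (* By the first integral [Psi (h t)] has derivative [1], so [Psi (h t) - t] is constant; it
     vanishes at [v0]. *)
  move=> Jv; apply/eqP; rewrite -subr_eq0; apply/eqP.
  have d0 t : J t -> is_derive t (1 : R) (fun s => Psi (h s) - s) 0.
    move=> Jt; have d := is_deriveB
      (is_derive1_comp (dPsi (h t)) (is_derive1P (sh 0 _ Jt))) (is_derive_id t (1 : R)).
    apply: is_derive_eq d _.
    by rewrite psi_integrandE -mulrA [_ `^ _ * _]mulrC [_ * _ `^ _](KE _ Jt) mulVf// subrr.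
  rewrite (is_derive0_itv_cst itvJ d0 Jv Jv0) /Psi; ring.
exists a, b, c2, Psi, Psi_inv; split.
  split=> //; split=> // t Jt.
  by rewrite -[in LHS](Psih _ Jt) PsiK Psih.
by move=> u v Iu Jv; rewrite (gE _ Iu).2 -[in RHS](Psih _ Jv) PsiK.
Qed.

(** Freezing first [u] at [u0], then [v] at [v0], shows that the factors of a product are unique up
    to a constant. *)
Lemma Psi_data_proportional m I J g h (a b c2 : R) Psi Psi_inv :
  I !=set0 -> J !=set0 ->
  (forall u, I u -> g u != 0 /\ derive1 g u != 0) ->
  (forall v, J v -> h v != 0 /\ derive1 h v != 0) ->
  Psi_data m J a c2 Psi Psi_inv ->
  (forall u v, I u -> J v -> g u * h v = (a * u + b) * Psi_inv v) ->
  exists c : R, [/\ c != 0, forall v, J v -> Psi_inv v = c * h v &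
    forall u, I u -> g u = (a * u + b) * c].
Proof.
move=> [u0 Iu0] [v0 Jv0] g0 h0 PD eq.
have l0 : a * u0 + b != 0.
  apply/negP => /eqP l0; have /eqP := eq _ _ Iu0 Jv0; rewrite l0 mul0r mulf_eq0.
  by rewrite (negbTE (g0 _ Iu0).1) (negbTE (h0 _ Jv0).1).
have kE v : J v -> Psi_inv v = g u0 / (a * u0 + b) * h v.
  by move=> Jv; apply: (mulfI l0); rewrite -eq//; field.
exists (g u0 / (a * u0 + b)); split=> //.
  by rewrite mulf_neq0 ?invr_eq0// (g0 _ Iu0).1.
move=> u Iu; apply: (mulIf (h0 _ Jv0).1).
by rewrite eq// kE// mulrA.
Qed.

(** Once [c] is moved from [g] to [h], the second factor [k = c h] agrees with [Psi_inv] on [J].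
    Differentiating [Psi (k t) = t] gives the first integral, and differentiating that gives the
    equation. *)
Lemma Psi_data_equation m I J g h (a b c2 : R) Psi Psi_inv : (0 < m)%N ->
  open_interval I -> open_interval J -> smooth_on I g -> smooth_on J h ->
  (forall u, I u -> g u != 0 /\ derive1 g u != 0) ->
  (forall v, J v -> h v != 0 /\ derive1 h v != 0) ->
  Psi_data m J a c2 Psi Psi_inv ->
  (forall u v, I u -> J v -> g u * h v = (a * u + b) * Psi_inv v) ->
  forall u v, I u -> J v ->
    homothetical_equation m (g u) (derive1 g u) (derive1 (derive1 g) u)
      (h v) (derive1 h v) (derive1 (derive1 h) v).
Proof.
move=> m0 [oI itvI I0] [oJ itvJ J0] sg sh g0 h0 PD eq u v Iu Jv.
have [c [c0 kE gE]] := Psi_data_proportional I0 J0 g0 h0 PD eq.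
have [a0 c20 dPsi [PsiK KPsi]] := PD.
have [gu0 g'u0] := g0 _ Iu; have [hv0 h'v0] := h0 _ Jv.
have g'E t : I t -> derive1 g t = a * c.
  move=> It; rewrite (eq_derive1 oI It gE) derive1E.
  have d := is_derive1M (is_deriveD (is_derive1M (is_derive_cst (a : R) t (1 : R))
    (is_derive_id t (1 : R))) (is_derive_cst (b : R) t (1 : R)))
    (is_derive_cst (c : R) t (1 : R)).
  by have [_ ->] := d; rewrite /cst; ring.
have g''E : derive1 (derive1 g) u = 0 * c.
  by rewrite (eq_derive1 oI Iu g'E) derive1_cst mul0r.
have gcE : g u = (g u / c) * c by rewrite divfK.
rewrite g''E (g'E _ Iu) [X in homothetical_equation _ X]gcE.
rewrite -homothetical_equation_scale.
pose k t := c * h t.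
have dk t : J t -> is_derive t (1 : R) k (c * derive1 h t).
  move=> Jt; have d := is_derive1M (is_derive_cst (c : R) t (1 : R))
    (is_derive1P (sh 0 _ Jt)).
  by apply: is_derive_eq d _; rewrite mulr0 addr0.
have k'E t : J t -> derive1 k t = c * derive1 h t.
  by move=> Jt; rewrite derive1E; have [] := dk _ Jt.
have dk' t : J t -> is_derive t (1 : R) (derive1 k) (c * derive1 (derive1 h) t).
  move=> Jt; have d := is_derive1M (is_derive_cst (c : R) t (1 : R))
    (is_derive1P (sh 1%N _ Jt)).
  rewrite mulr0 addr0 in d; apply: near_eq_is_derive d.
  near=> s; apply/esym/k'E; near: s; exact: open_nbhs_nbhs.
have k0 t : J t -> k t != 0 by move=> Jt; rewrite mulf_neq0// (h0 _ Jt).1.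
have k'0 t : J t -> c * derive1 h t != 0.
  by move=> Jt; rewrite mulf_neq0// (h0 _ Jt).2.
apply/(homothetical_equation_affine _ m0 _ a0 (k0 _ Jv) (k'0 _ Jv)).
  by rewrite mulf_neq0 ?invr_eq0.
have Psik t : J t -> Psi (k t) = t by move=> Jt; rewrite /k -kE// KPsi.
have first t : J t ->
    derive1 k t * psi_base m a (k t) `^ (- ((2 * m - 1)%:R / m%:R)) = c2.
  move=> Jt; have d := is_derive1_comp (dPsi (k t)) (dk _ Jt).
  have := is_derive1_eq_on oJ Jt d (is_derive_id t (1 : R)) Psik.
  rewrite -/(psi_base m a (k t)) -/(psi_integrand m a c2 (k t)) psi_integrandE k'E// => e.
  by apply: (mulfI (invr_neq0 c20)); rewrite mulVf// -[RHS]e; ring.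
have [dkv dk'v] := (dk _ Jv, dk' _ Jv).
have ex1 : derivable k v 1 by have [] := dkv.
have ex2 : derivable (derive1 k) v 1 by have [] := dk'v.
have d := is_derive_first_integral m0 a0 ex1 ex2 (k0 _ Jv).
have := is_derive1_eq_on oJ Jv d (is_derive_cst (c2 : R) v (1 : R)) first.
have k''E : derive1 (derive1 k) v = c * derive1 (derive1 h) v.
  by rewrite derive1E; have [] := dk'v.
rewrite k''E k'E// => /eqP; rewrite mulf_eq0 gt_eqF ?powR_gt0 ?psi_base_gt0//=.
by move/eqP.
Unshelve. all: by end_near. Qed.

(** Away from [0] the odd root in the integrand is smooth by [Ck2_on_odd_root]. A dummy second
    variable, running over the whole line, allows the two-variable closure lemmas to be reused. *)
Lemma smooth_on_Psi m (a c2 : R) Psi K : (0 < m)%N -> open K -> ~ K 0 ->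
  a != 0 -> Psi_antiderivative m a c2 Psi -> smooth_on K Psi.
Proof.
move=> m0 oK K0 a0 dPsi.
have oT : open [set: R] by exact: openT.
have Kneq0 s : K s -> s != 0 by move=> Ks; apply/eqP => s0; apply: K0; rewrite -s0.
have Cid n : Ck2_on n K [set: R] (fun u _ => u).
  have cfst u v : {for (u, v), continuous (fun p : R * R => p.1)} by exact: cvg_fst.
  case: n => [|n]; first by split=> // u v _ _; exact: cfst.
  split; first by move=> u v _ _; exact: cfst.
  split.
  - by move=> u v _ _; split; [exact: derivable_id|exact: derivable_cst].
  - apply: eq_Ck2_on (Ck2_on_cst oK oT n 1) => // u v _ _.
    by rewrite /partial1 derive1_id.
  - apply: eq_Ck2_on (Ck2_on_cst oK oT n 0) => // u v _ _.
    by rewrite /partial2 derive1_cst.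
have CQ n : Ck2_on n K [set: R] (fun u _ => psi_base m a u).
  apply: (Ck2_onD oK oT (Ck2_on_cst oK oT n _)).
  apply: (Ck2_onM oK oT (Ck2_on_cst oK oT n _)).
  apply: (Ck2_onX oK oT (2 * m)).
  by apply: (Ck2_on_odd_root _ oK oT _ (Cid n)) => u v Ku _; exact: Kneq0.
have Cf n : Ck2_on n K [set: R] (fun u _ => psi_integrand m a c2 u).
  have C := Ck2_onM oK oT (Ck2_on_cst oK oT n c2^-1)
    (Ck2_on_powR oK oT (- ((2 * m - 1)%:R / m%:R)) (fun u _ _ _ => psi_base_gt0 u m0 a0) (CQ n)).
  by apply: eq_Ck2_on C => // u v _ _; rewrite psi_integrandE.
have dP s : derivable Psi s 1 by have [] := dPsi s.
have cPsi (u v : R) : {for (u, v), continuous (fun p : R * R => Psi p.1)}.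
  apply: (@continuous_comp _ _ _ fst Psi); first exact: cvg_fst.
  exact: derivable1_continuous.
apply: (smooth2_on_fst (J := [set: R]) (v := 0)) => // -[|n].
  by split=> // u v _ _; exact: cPsi.
split; first by move=> u v _ _; exact: cPsi.
split.
- by move=> u v _ _; split; [exact: dP|exact: derivable_cst].
- apply: eq_Ck2_on (Cf n) => // u v _ _.
  by rewrite /partial1 derive1E; have [_ ->] := dPsi u.
- apply: eq_Ck2_on (Ck2_on_cst oK oT n 0) => // u v _ _.
  by rewrite /partial2 derive1_cst.
Qed.

Lemma eq_smooth_on J f k : open J -> (forall t, J t -> f t = k t) ->
  smooth_on J f -> smooth_on J k.
Proof.
move=> oJ fk sf; have oT : open [set: R] by exact: openT.
apply: (smooth2_on_fst (J := [set: R]) (v := 0)) => // n.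
by apply: eq_Ck2_on (Ck2_on_fst oJ oT n sf) => // u v Ju _; exact: fk.
Qed.

Lemma smooth_onZ J f (c : R) : open J -> smooth_on J f ->
  smooth_on J (fun t => c * f t).
Proof.
move=> oJ sf; have oT : open [set: R] by exact: openT.
apply: (smooth2_on_fst (J := [set: R]) (v := 0)) => // n.
exact: (Ck2_onM oJ oT (Ck2_on_cst oJ oT n c) (Ck2_on_fst oJ oT n sf)).
Qed.

(** On [J] the inverse is [c h], hence smooth and without zeros; so the preimage of [J] misses [0],
    and [Psi] is smooth on it. *)
Lemma Psi_data_diffeomorphism m I J g h (a b c2 : R) Psi Psi_inv : (0 < m)%N ->
  I !=set0 -> open_interval J -> smooth_on J h ->
  (forall u, I u -> g u != 0 /\ derive1 g u != 0) ->
  (forall v, J v -> h v != 0 /\ derive1 h v != 0) ->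
  Psi_data m J a c2 Psi Psi_inv ->
  (forall u v, I u -> J v -> g u * h v = (a * u + b) * Psi_inv v) ->
  diffeomorphism (Psi @^-1` J) J Psi Psi_inv.
Proof.
move=> m0 I0 [oJ _ J0] sh g0 h0 PD eq.
have [c [c0 kE _]] := Psi_data_proportional I0 J0 g0 h0 PD eq.
have [a0 c20 dPsi [PsiK KPsi]] := PD.
have cPsi : continuous Psi.
  by move=> s; apply: derivable1_continuous; have [] := dPsi s.
have oK : open (Psi @^-1` J) by move/continuousP : cPsi; apply.
split=> //.
- by split=> // t Jt; rewrite /preimage/= KPsi.
- split; last first.
    by apply: (eq_smooth_on oJ _ (smooth_onZ (c := c) oJ sh)) => t Jt; rewrite kE.
  apply: (smooth_on_Psi m0 oK _ a0 dPsi) => J0'.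
  have := kE _ J0'; rewrite PsiK => /esym/eqP.
  by rewrite mulf_eq0 (negbTE c0) (negbTE (h0 _ J0').1).
Qed.

End PsiData.

(** The minimal surface equation is symmetric in the two factors, so the affine one may depend on
    [u] or on [v]: the second alternative is the first with the coordinates exchanged. The last
    clause is the reparametrization by [u] and the value of [Psi_inv]. *)
Theorem theorem5p1 (R : realType) (m : nat) (I J : set R) (g h : R -> R)
    (m_ge2 : (2 <= m)%N)
    (I_itv : open_interval I) (J_itv : open_interval J)
    (g_smooth : smooth_on I g) (h_smooth : smooth_on J h)
    (g_neq0 : forall u, I u -> g u != 0 /\ derive1 g u != 0)
    (h_neq0 : forall v, J v -> h v != 0 /\ derive1 h v != 0) :
  (minimal_surface m I J (homothetical g h) <->
    (exists (a b c2 : R) (Psi Psi_inv : R -> R),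
       Psi_data m J a c2 Psi Psi_inv /\
       equal_on I J (homothetical g h)
         (fun u v => row3 u v ((a * u + b) * Psi_inv v)))
    \/
    (exists (a b c2 : R) (Psi Psi_inv : R -> R),
       Psi_data m I a c2 Psi Psi_inv /\
       equal_on I J (homothetical g h)
         (fun u v => row3 u v ((a * v + b) * Psi_inv u)))) /\
  (forall (a b c2 : R) (Psi Psi_inv : R -> R),
     Psi_data m J a c2 Psi Psi_inv ->
     equal_on I J (homothetical g h)
       (fun u v => row3 u v ((a * u + b) * Psi_inv v)) ->
     diffeomorphism (Psi @^-1` J) J Psi Psi_inv /\
     equal_on I (Psi @^-1` J)
       (fun u s => homothetical g h u (Psi s))
       (fun u s => row3 u (Psi s) ((a * u + b) * s))).
Proof.
have m0 : (0 < m)%N by exact: ltnW.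
have [oI _ I0] := I_itv; have [oJ _ J0] := J_itv.
have row3_inj (x y s t : R) : row3 x y s = row3 x y t -> s = t.
  by move=> /rowP/(_ 2); rewrite !row3E.
split; last first.
  move=> a b c2 Psi Psi_inv PD eq.
  have eq' u v : I u -> J v -> g u * h v = (a * u + b) * Psi_inv v.
    by move=> Iu Jv; exact: (row3_inj _ _ _ _ (eq _ _ Iu Jv)).
  split; first exact: (Psi_data_diffeomorphism m0 I0 J_itv h_smooth g_neq0 h_neq0 PD eq').
  move=> u s Iu Js; rewrite /homothetical eq'//.
  by have [_ _ _ [PsiK _]] := PD; rewrite PsiK.
pose eqn := forall u v, I u -> J v ->
  homothetical_equation m (g u) (derive1 g u) (derive1 (derive1 g) u)
    (h v) (derive1 h v) (derive1 (derive1 h) v).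
(* The equation does not mention the normal, whereas minimality asserts that one exists; the
   converse therefore takes the one from [birkhoff_gauss_exists]. *)
have minimalP : minimal_surface m I J (homothetical g h) <-> eqn.
  split=> [[N bN HN] u v Iu Jv|eq].
    apply/(mean_curvature_eq0 m_ge2 oI oJ g_smooth h_smooth g_neq0 h_neq0 bN Iu Jv).
    exact: HN.
  have [N bN] := birkhoff_gauss_exists m_ge2 oI oJ g_smooth h_smooth g_neq0 h_neq0.
  exists N => // u v Iu Jv.
  apply/(mean_curvature_eq0 m_ge2 oI oJ g_smooth h_smooth g_neq0 h_neq0 bN Iu Jv).
  exact: eq.
apply: (iff_trans minimalP); split=> [eq|].
  have [g2|h2] :=
      homothetical_equation_split m0 oI oJ g_smooth h_smooth g_neq0 h_neq0 eq.
    left; have [a [b [c2 [Psi [Psi_inv [PD E]]]]]] :=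
      affine_factor_Psi_data m0 I_itv J_itv g_smooth h_smooth g_neq0 h_neq0 eq g2.
    exists a, b, c2, Psi, Psi_inv; split=> // u v Iu Jv.
    by rewrite /homothetical E.
  have eqC v u (Jv : J v) (Iu : I u) := homothetical_equationC (eq _ _ Iu Jv).
  right; have [a [b [c2 [Psi [Psi_inv [PD E]]]]]] :=
    affine_factor_Psi_data m0 J_itv I_itv h_smooth g_smooth h_neq0 g_neq0 eqC h2.
  exists a, b, c2, Psi, Psi_inv; split=> // u v Iu Jv.
  by rewrite /homothetical mulrC E.
move=> [|] [a [b [c2 [Psi [Psi_inv [PD E]]]]]] u v Iu Jv.
  have E' s t : I s -> J t -> g s * h t = (a * s + b) * Psi_inv t.
    by move=> Is Jt; exact: (row3_inj _ _ _ _ (E _ _ Is Jt)).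
  exact: (Psi_data_equation m0 I_itv J_itv g_smooth h_smooth g_neq0 h_neq0 PD E').
have E' t s : J t -> I s -> h t * g s = (a * t + b) * Psi_inv s.
  by move=> Jt Is; rewrite mulrC; exact: (row3_inj _ _ _ _ (E _ _ Is Jt)).
apply: homothetical_equationC.
exact: (Psi_data_equation m0 J_itv I_itv h_smooth g_smooth h_neq0 g_neq0 PD E').
Qed.
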